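(* Let $\ell\ge2$ and let $w_\ell=x^\ell$. Then there is $N=N(\ell)$ such that for every $n\ge N$, we have $\tau_{w_\ell,\mathrm{SU}_n}^{*(\ell-1)}\notin L^\infty(\mathrm{SU}_n)$.
   Context: $\tau_{w_\ell,\mathrm{SU}_n}$ is the distribution of $\mathsf{G}^\ell$, where $\mathsf{G}$ is a Haar-distributed random element of $\mathrm{SU}_n$. $\tau^{*t}$ is the $t$-th convolution power of the measure $\tau$ on the group $\mathrm{SU}_n$; a measure is said to be in $L^\infty(\mathrm{SU}_n)$ if it is absolutely continuous with respect to the Haar probability measure with essentially bounded density. *)

(* Defs.v *)
From HB Require Import structures.
From mathcomp Require Import all_boot all_order all_algebra.
From mathcomp Require Import all_classical all_reals all_analysis measurable_realfun.
From mathcomp Require Import complex lra.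

Set Implicit Arguments.
Unset Strict Implicit.
Unset Printing Implicit Defensive.

Import Order.TTheory GRing.Theory Num.Theory.
Import numFieldNormedType.Exports.

Local Open Scope classical_set_scope.
Local Open Scope ring_scope.

(* The library topologizes abstract number fields, but not the concrete       *)
(* complex numbers R[i]; their topology is the one of the modulus.            *)
#[export, non_forgetful_inheritance]
HB.instance Definition _ (R : rcfType) :=
  NormedModule.copy R[i] ((R[i] : numClosedFieldType)^o).

Section special_unitary_group.
Context (R : realType) (n : nat).

Record SU := SUOf {
  SU_val :> 'M[R[i]]_n;
  SU_valP : (SU_val \is unitarymx) && (\det SU_val == 1) }.

HB.instance Definition _ := [isSub for SU_val].
HB.instance Definition _ := [Choice of SU by <:].

Lemma SU_unitary (g : SU) : SU_val g \is unitarymx.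
Proof. by have /andP[] := SU_valP g. Qed.

Lemma SU_det (g : SU) : \det (SU_val g) = 1.
Proof. by have /andP[_ /eqP] := SU_valP g. Qed.

Fact SU_one_subproof :
  ((1%:M : 'M[R[i]]_n) \is unitarymx) && (\det (1%:M : 'M[R[i]]_n) == 1).
Proof.
rewrite det1 eqxx andbT; apply/unitarymxP.
by rewrite mul1mx trmx1 map_mx1.
Qed.

Fact SU_mul_subproof (g h : SU) :
  (SU_val g *m SU_val h \is unitarymx) && (\det (SU_val g *m SU_val h) == 1).
Proof.
by rewrite mul_unitarymx ?SU_unitary//= det_mulmx !SU_det mulr1.
Qed.

Fact SU_inv_subproof (g : SU) :
  (invmx (SU_val g) \is unitarymx) && (\det (invmx (SU_val g)) == 1).
Proof.
rewrite det_inv SU_det invr1 eqxx andbT.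
by rewrite invmx_unitary ?trmxC_unitary ?SU_unitary.
Qed.

Definition SU_one : SU := SUOf SU_one_subproof.
Definition SU_mul (g h : SU) : SU := SUOf (SU_mul_subproof g h).
Definition SU_inv (g : SU) : SU := SUOf (SU_inv_subproof g).

Fact SU_mulA : associative SU_mul.
Proof. by move=> g h k; apply: val_inj; rewrite /= mulmxA. Qed.

Fact SU_mul1 : left_id SU_one SU_mul.
Proof. by move=> g; apply: val_inj; rewrite /= mul1mx. Qed.

Fact SU_mulr1 : right_id SU_one SU_mul.
Proof. by move=> g; apply: val_inj; rewrite /= mulmx1. Qed.

Fact SU_mulV : left_inverse SU_one SU_inv SU_mul.
Proof.
move=> g; apply: val_inj.
by rewrite /= mulVmx // unitarymx_unit // SU_unitary.
Qed.

Fact SU_mulrV : right_inverse SU_one SU_inv SU_mul.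
Proof.
move=> g; apply: val_inj.
by rewrite /= mulmxV // unitarymx_unit // SU_unitary.
Qed.

HB.instance Definition _ :=
  isGroup.Build SU SU_mulA SU_mul1 SU_mulr1 SU_mulV SU_mulrV.
HB.instance Definition _ := isPointed.Build SU SU_one.

(* Subspace topology from the matrices, and its Borel sigma-algebra. *)
HB.instance Definition _ := Topological.copy SU (initial_topology SU_val).
HB.instance Definition _ :=
  Measurable.copy SU (g_sigma_algebraType (@open SU)).

End special_unitary_group.

Section measurability_of_the_group_operations.
Context (R : realType) (n : nat).
Local Notation G := (SU R n).
Local Notation Re := complex.Re.
Local Notation Im := complex.Im.

Lemma normci : `|'i%C : R[i]| = 1.
Proof. by rewrite normc_def /= expr0n/= add0r expr1n sqrtr1. Qed.

Lemma normc_real (x : R) : `|x%:C%C| = `|x|%:C%C :> R[i].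
Proof. by rewrite normc_def /= expr0n/= addr0 sqrtr_sqr. Qed.

Lemma normc_Re_le (z : R[i]) (e : R) : `|z| < e%:C%C -> `|Re z| < e.
Proof.
move=> ze; rewrite -ltcR; apply: le_lt_trans ze; exact: normc_ge_Re.
Qed.

Lemma normc_Im_le (z : R[i]) (e : R) : `|z| < e%:C%C -> `|Im z| < e.
Proof.
move=> ze; rewrite -normrN -ReiNIm; apply: normc_Re_le.
by rewrite normrM normci mulr1.
Qed.

Lemma normc_lt (z : R[i]) (e : R) :
  `|Re z| < e -> `|Im z| < e -> `|z| < (e *+ 2)%:C%C.
Proof.
move=> re im; rewrite {1}[z]complexE (le_lt_trans (ler_normD _ _))//.
rewrite normrM normci mul1r !normc_real mulr2n rmorphD /=.
by rewrite ltrD// ltcR.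
Qed.

Lemma open_SU_entry (P : R[i] -> Prop) i j :
    (forall z, P z -> exists2 e : R, 0 < e &
      forall w, `|z - w| < e%:C%C -> P w) ->
  open [set g : G | P (g i j)].
Proof.
move=> oP; exists [set M : 'M[R[i]]_n | P (M i j)] => //.
rewrite openE => M /= /oP[e e0 eP]; apply/nbhs_ballP.
exists e%:C%C; first by rewrite /= ltcR.
by move=> N [_ /(_ i j)]; rewrite -ball_normE /= => /eP.
Qed.

Lemma measurable_SU_Re i j : measurable_fun setT (fun g : G => Re (g i j)).
Proof.
apply: (measurability _ (RGenOInfty.measurableE R)) => // _ [_ [x ->] <-].
rewrite setTI; apply: sub_sigma_algebra.
rewrite [X in open X](_ : _ = [set g : G | x < Re (g i j)]); last first.
  by apply/seteqP; split => g /=; rewrite in_itv/= andbT.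
apply: (open_SU_entry (P := fun z => x < Re z)) => z xz.
exists (Re z - x); first by rewrite subr_gt0.
move=> w /normc_Re_le; rewrite raddfB/= => /ltr_normlW; lra.
Qed.

Lemma measurable_SU_Im i j : measurable_fun setT (fun g : G => Im (g i j)).
Proof.
apply: (measurability _ (RGenOInfty.measurableE R)) => // _ [_ [x ->] <-].
rewrite setTI; apply: sub_sigma_algebra.
rewrite [X in open X](_ : _ = [set g : G | x < Im (g i j)]); last first.
  by apply/seteqP; split => g /=; rewrite in_itv/= andbT.
apply: (open_SU_entry (P := fun z => x < Im z)) => z xz.
exists (Im z - x); first by rewrite subr_gt0.
move=> w /normc_Im_le; rewrite raddfB/= => /ltr_normlW; lra.
Qed.

Lemma measurable_SU d (T : measurableType d) (f : T -> G) :
    (forall i j, measurable_fun setT (fun t => Re (f t i j))) ->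
    (forall i j, measurable_fun setT (fun t => Im (f t i j))) ->
  measurable_fun setT f.
Proof.
move=> mRe mIm.
pose I := ('M[rat]_n * 'M[rat]_n * nat)%type.
pose box (q : I) := [set g : G | forall ij,
  `|Re (g ij.1 ij.2) - ratr (q.1.1 ij.1 ij.2)| < q.2.+1%:R^-1 /\
  `|Im (g ij.1 ij.2) - ratr (q.1.2 ij.1 ij.2)| < q.2.+1%:R^-1].
have mabs (h : T -> R) (a e : R) : measurable_fun setT h ->
    measurable [set t | `|h t - a| < e].
  move=> mh.
  have mha : measurable_fun setT (fun t => `|h t - a|).
    apply: (measurableT_comp (@normr_measurable R setT)) => //.
    exact: measurable_funB.
  rewrite (_ : [set _ | _] =
    setT `&` (fun t => `|h t - a|) @^-1` `]-oo, e[%classic).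
    exact: mha measurableT _ (measurable_itv _).
  by rewrite setTI; apply/seteqP; split => t /=; rewrite in_itv.
have mbox q : measurable (f @^-1` box q).
  rewrite (_ : _ @^-1` _ = \bigcap_(ij in [set: 'I_n * 'I_n])
     ([set t | `|Re (f t ij.1 ij.2) - ratr (q.1.1 ij.1 ij.2)| < q.2.+1%:R^-1]
  `&` [set t | `|Im (f t ij.1 ij.2) - ratr (q.1.2 ij.1 ij.2)| < q.2.+1%:R^-1])).
    apply: fin_bigcap_measurable => [|ij _]; first exact: finite_finset.
    by apply: measurableI; exact: mabs.
  by apply/seteqP; split => t /= H ij; [move=> _|]; exact: H.
apply: (measurability (@open G)) => // _ [A [B oB <-] <-].
rewrite setTI.
rewrite (_ : f @^-1` _ =
    \bigcup_(q in [set q | box q `<=` @SU_val R n @^-1` B]) f @^-1` box q).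
  rewrite bigcup_mkcond; apply: countable_bigcupT_measurable => [|q].
    exact: countableP.
  by case: ifPn => // _; exact: mbox.
apply/seteqP; split => [t /= Bt|t [q /= qB qt]]; last exact: (qB (f t)).
have /nbhs_ballP[e /= e0 eB] := open_nbhs_nbhs (conj oB Bt).
have eE : e = (Re e)%:C%C by rewrite RRe_real// gtr0_real.
have re0 : 0 < Re e by rewrite -ltcR -eE.
have [k ke] : exists k, k.+1%:R^-1 < Re e / 4.
  exists (Num.truncn (Re e / 4)^-1).
  rewrite invf_plt ?posrE ?divr_gt0//.
  by rewrite truncnS_gt.
have appr (x : R) : {q : rat | `|x - ratr q| < k.+1%:R^-1}.
  apply: cid.
  have /rat_in_itvoo[q] : x - k.+1%:R^-1 < x + k.+1%:R^-1.
    by rewrite ltrD2l (lt_trans (y := 0))// ?oppr_lt0 ?invr_gt0.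
  by rewrite in_itv/= -ltr_distl distrC => xq; exists q.
pose q1 := \matrix_(i, j) sval (appr (Re (f t i j))).
pose q2 := \matrix_(i, j) sval (appr (Im (f t i j))).
exists ((q1, q2), k) => /=; last first.
  by move=> ij /=; rewrite !mxE; split; [case: (appr (Re _))|case: (appr (Im _))].
move=> g gq /=; apply: eB; split => // i j; rewrite -ball_normE /=.
have [] := gq (i, j); rewrite /= !mxE.
case: (appr (Re _)) => a /= fa; case: (appr (Im _)) => b /= fb ga gb.
rewrite eE (@lt_trans _ _ (k.+1%:R^-1 *+ 2 *+ 2)%:C%C)//; last first.
  by rewrite ltcR -mulrnA -[_ *+ (2 * 2)]mulr_natr -ltr_pdivlMr.
have tri (x y z u : R) : `|x - y| < u -> `|z - y| < u -> `|x - z| < u *+ 2.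
  move=> xy zy; rewrite mulr2n (le_lt_trans (ler_distD y _ _))// ltrD//.
  by rewrite distrC.
by apply: normc_lt; rewrite raddfB/=; [exact: tri fa ga|exact: tri fb gb].
Qed.

Lemma measurable_SU_mul :
  measurable_fun setT (fun p : G * G => (p.1 * p.2)%g).
Proof.
have m1 i j : measurable_fun setT (fun p : G * G => Re (p.1 i j)).
  exact: measurableT_comp (measurable_SU_Re i j) measurable_fst.
have m2 i j : measurable_fun setT (fun p : G * G => Re (p.2 i j)).
  exact: measurableT_comp (measurable_SU_Re i j) measurable_snd.
have m3 i j : measurable_fun setT (fun p : G * G => Im (p.1 i j)).
  exact: measurableT_comp (measurable_SU_Im i j) measurable_fst.
have m4 i j : measurable_fun setT (fun p : G * G => Im (p.2 i j)).
  exact: measurableT_comp (measurable_SU_Im i j) measurable_snd.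
apply: measurable_SU => i j.
- rewrite (_ : (fun _ => _) = fun p : G * G =>
    \sum_k (Re (p.1 i k) * Re (p.2 k j) - Im (p.1 i k) * Im (p.2 k j))).
    apply: measurable_sum => k; apply: measurable_funB;
    exact: measurable_funM.
  apply/funext => p; rewrite mxE raddf_sum; apply: eq_bigr => k _.
  by case: (SU_val p.1 i k) => ? ?; case: (SU_val p.2 k j).
- rewrite (_ : (fun _ => _) = fun p : G * G =>
    \sum_k (Re (p.1 i k) * Im (p.2 k j) + Im (p.1 i k) * Re (p.2 k j))).
    apply: measurable_sum => k; apply: measurable_funD;
    exact: measurable_funM.
  apply/funext => p; rewrite mxE raddf_sum; apply: eq_bigr => k _.
  by case: (SU_val p.1 i k) => ? ?; case: (SU_val p.2 k j).
Qed.

Lemma measurable_SU_expg l : measurable_fun setT (fun g : G => (g ^+ l)%g).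
Proof.
elim: l => [|l IH]; first exact: measurable_cst.
rewrite (_ : (fun _ => _) =
  (fun p : G * G => (p.1 * p.2)%g) \o (fun g : G => (g, (g ^+ l)%g))).
  apply: measurableT_comp; first exact: measurable_SU_mul.
  exact: measurable_fun_pair.
by apply/funext => g; rewrite expgS.
Qed.

Definition mul_pair (p : G * G) : G := (p.1 * p.2)%g.
Definition power_word (l : nat) (g : G) : G := (g ^+ l)%g.

HB.instance Definition _ :=
  isMeasurableFun.Build _ _ _ _ mul_pair measurable_SU_mul.
HB.instance Definition _ l :=
  isMeasurableFun.Build _ _ _ _ (power_word l) (measurable_SU_expg l).

End measurability_of_the_group_operations.

Section measures_on_SU.
Context (R : realType) (n : nat).
Local Notation G := (SU R n).

(* SU_n is compact, so the left-invariant Borel probability measure is unique  *)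
(* and is the bi-invariant Haar probability measure.                          *)
Definition is_Haar (mu : probability G R) : Prop :=
  forall (g : G) (A : set G), measurable A ->
    mu [set (g * x)%g | x in A] = mu A.

Definition word_measure (mu : probability G R) (l : nat) : probability G R :=
  distribution mu (@power_word R n l).

Definition convolution (mu nu : probability G R) : probability G R :=
  distribution (mu \x nu)%E (@mul_pair R n).

(* The unit mass at the identity is the neutral element of convolution.       *)
Definition convolution_power (tau : probability G R) (t : nat) :
    probability G R :=
  iter t (convolution tau) (dirac (1%g : G)).

End measures_on_SU.

(* Absolute continuity with respect to mu is expressed by the existence of a  *)
(* density f; the norm behind Lfun mu +oo is the essential supremum of |f|.   *)
Definition in_Linfty d (T : measurableType d) (R : realType)
    (mu nu : {measure set T -> \bar R}) : Prop :=
  exists2 f : T -> R, f \in Lfun mu +oo%E &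
    forall A, measurable A -> nu A = (\int[mu]_(x in A) (f x)%:E)%E.

(* Main.v *)
From HB Require Import structures.
Require Import Defs.
From mathcomp Require Import all_boot all_order all_algebra.
From mathcomp Require Import all_classical all_reals all_analysis.
From mathcomp Require Import measurable_realfun ess_sup_inf.
From mathcomp Require Import complex cyclotomic separable ring lra zify.

Set Implicit Arguments.
Unset Strict Implicit.
Unset Printing Implicit Defensive.

Import Order.TTheory GRing.Theory Num.Theory.
Import numFieldNormedType.Exports.

Local Open Scope classical_set_scope.
Local Open Scope sesquilinear_scope.
Local Open Scope ring_scope.

(** Write [B r] for the ball of radius [r] around the identity of SU_n, and
    [E r] for the set of the [g] with [g ^+ l] in [B r].  The proof compares
    the decay of the Haar masses of these sets as [r] tends to 0.

    Let [D] be a diagonal matrix of determinant 1 whose eigenvalues are l-th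
    roots of unity with nearly equal multiplicities.  All conjugates of [D]
    solve [g ^+ l = 1], so [E r] contains a tube around the conjugacy class of
    [D].  The codimension of this class is the dimension of the centralizer of
    [D], which is about n^2/l, so [E r] has mass at least of the order of
    r^(n^2/l + O(n)) ([near_roots_mass_ge]).  If the (l-1)-st convolution power
    of the law of [g ^+ l] had a bounded density, then, as a product of l-1
    elements of [B r] lies in [B (a * r)] for a constant [a]
    ([convolution_power_ge]), the mass of [B (a * r)] would be at least of the
    order of r^((l-1)(n^2/l + O(n))).  But this mass is at most of the order of
    r^(n(n-1)) ([bmass_le]), and the first exponent is the smaller one as soon
    as n exceeds a multiple of l^2.

    Both estimates come from counting, without a smooth structure.  Left
    invariance gives all balls of radius [r] the same mass, so packings bound
    it from above and coverings from below ([mass_pack], [mass_cover]).  An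
    error of O(n) in the exponents is harmless, which permits two crude
    devices.
    - Near the identity, a unitary matrix is determined, in a Lipschitz way, by
      its entries on and below the diagonal, because [X + X^t* + X *m X^t* = 0]
      for [X = g - 1] ([dev_le_half]).  Thus the elements near the identity
      that almost commute with [D] are covered by few small balls
      ([tube_net]).  Two elements [u] and [u'] whose conjugates [u D u^-1] and
      [u' D u'^-1] are close differ by such an element ([near_conj_tube]), so a
      maximal family of disjoint balls centred at conjugates of [D] is large.
    - The Cayley transforms of the points of a grid of skew-Hermitian matrices,
      corrected to have determinant 1, are well separated ([SU_cayley_sep]),
      which packs many disjoint balls into SU_n. *)

(** * A submultiplicative norm on complex matrices *)

Section matrix_norm.
Context (R : realType).
Local Notation Re := complex.Re.
Local Notation Im := complex.Im.
Implicit Types z w : R[i].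

(** The sum of the absolute values of the two parts is a real number, whereas
    the norm of [R[i]] takes its values in [R[i]]; it is submultiplicative and
    invariant under conjugation, which is all that the estimates need. *)
Definition cabs z : R := locked (`|Re z| + `|Im z|).

Lemma cabsE z : cabs z = `|Re z| + `|Im z|.
Proof. by rewrite /cabs -lock. Qed.

Lemma cabs_ge0 z : 0 <= cabs z.
Proof. by rewrite !cabsE addr_ge0. Qed.

Lemma cabs0 : cabs 0 = 0.
Proof. by rewrite !cabsE /= normr0 addr0. Qed.

Lemma cabs1 : cabs 1 = 1.
Proof. by rewrite !cabsE /= normr1 normr0 addr0. Qed.

Lemma cabsN z : cabs (- z) = cabs z.
Proof. by case: z => a b; rewrite !cabsE /= !normrN. Qed.

Lemma cabsD z w : cabs (z + w) <= cabs z + cabs w.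
Proof.
case: z w => a b [c d]; rewrite !cabsE /=.
have := ler_normD a c; have := ler_normD b d; lra.
Qed.

Lemma cabsM z w : cabs (z * w) <= cabs z * cabs w.
Proof.
case: z w => a b [c d]; rewrite !cabsE /=.
have := ler_normB (a * c) (b * d); have := ler_normD (a * d) (b * c).
by rewrite !normrM; lra.
Qed.

Lemma cabs_conj z : cabs z^* = cabs z.
Proof. by case: z => a b; rewrite !cabsE /= normrN. Qed.

Lemma cabs_le2 z : `|z| <= 1 -> cabs z <= 2.
Proof.
move=> z1; have h1 := le_trans (normc_ge_Re z) z1.
have h2 : `|Im z|%:C%C <= `|z| :> R[i].
  by rewrite -normrN -ReiNIm (le_trans (normc_ge_Re _))// normrM normci mulr1.
have {}h2 := le_trans h2 z1.
by move: h1 h2; rewrite -!(rmorph1 (real_complex R)) !lecR cabsE; lra.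
Qed.

Lemma le_cabs_sum (I : Type) (s : seq I) (P : pred I) (F : I -> R[i]) :
  cabs (\sum_(i <- s | P i) F i) <= \sum_(i <- s | P i) cabs (F i).
Proof.
elim/big_ind2: _ => [|x1 x2 y1 y2 h1 h2|//]; first by rewrite cabs0.
by rewrite (le_trans (cabsD _ _))// lerD.
Qed.

Definition mnorm m n (M : 'M[R[i]]_(m, n)) : R := \sum_i \sum_j cabs (M i j).

Lemma mnorm_ge0 m n (M : 'M[R[i]]_(m, n)) : 0 <= mnorm M.
Proof. by apply: sumr_ge0 => i _; apply: sumr_ge0 => j _; exact: cabs_ge0. Qed.

Lemma cabs_le_mnorm m n (M : 'M[R[i]]_(m, n)) i j : cabs (M i j) <= mnorm M.
Proof.
rewrite /mnorm (bigD1 i)//= (bigD1 j)//= -addrA lerDl addr_ge0//.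
  by apply: sumr_ge0 => ? _; exact: cabs_ge0.
by apply: sumr_ge0 => ? _; apply: sumr_ge0 => ? _; exact: cabs_ge0.
Qed.

Lemma mnormN m n (M : 'M[R[i]]_(m, n)) : mnorm (- M) = mnorm M.
Proof. by do 2!apply: eq_bigr => ? _; rewrite mxE cabsN. Qed.

Lemma mnormD m n (M M' : 'M[R[i]]_(m, n)) : mnorm (M + M') <= mnorm M + mnorm M'.
Proof.
rewrite /mnorm -big_split /=; apply: ler_sum => i _.
by rewrite -big_split /=; apply: ler_sum => j _; rewrite mxE cabsD.
Qed.

Lemma mnormB m n (M M' : 'M[R[i]]_(m, n)) : mnorm (M - M') <= mnorm M + mnorm M'.
Proof. by rewrite -[mnorm M']mnormN mnormD. Qed.

Lemma mnormM m n p (M : 'M[R[i]]_(m, n)) (M' : 'M[R[i]]_(n, p)) :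
  mnorm (M *m M') <= mnorm M * mnorm M'.
Proof.
rewrite /mnorm big_distrl /=; apply: ler_sum => i _.
apply: (@le_trans _ _ (\sum_k \sum_j cabs (M i j) * cabs (M' j k))).
  apply: ler_sum => k _; rewrite mxE (le_trans (le_cabs_sum _ _ _))//.
  by apply: ler_sum => j _; exact: cabsM.
rewrite exchange_big /= big_distrl /=; apply: ler_sum => j _.
rewrite -big_distrr /= ler_wpM2l ?cabs_ge0//.
rewrite (bigD1 j)//= lerDl.
by apply: sumr_ge0 => ? _; apply: sumr_ge0 => ? _; exact: cabs_ge0.
Qed.

Lemma mnorm_le m n (M : 'M[R[i]]_(m, n)) (e : R) :
  (forall i j, cabs (M i j) <= e) -> mnorm M <= m%:R * n%:R * e.
Proof.
move=> Me; have -> : m%:R * n%:R * e = \sum_(i < m) \sum_(j < n) e.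
  by rewrite !sumr_const !card_ord -mulrnA -[RHS]mulr_natr natrM; ring.
by apply: ler_sum => i _; apply: ler_sum => j _.
Qed.

Lemma mnorm_trC n (M : 'M[R[i]]_n) : mnorm (M ^t*) = mnorm M.
Proof.
rewrite /mnorm exchange_big; do 2!apply: eq_bigr => ? _.
by rewrite !mxE -[in LHS]/(_^*)%C cabs_conj.
Qed.

Lemma unitary_entry_le1 n (M : 'M[R[i]]_n) i j : M \is unitarymx -> `|M i j| <= 1.
Proof.
move/unitarymxP/matrixP/(_ i i); rewrite !mxE eqxx /= => h.
rewrite -(@ler_pXn2r _ 2)// ?nnegrE// expr1n.
apply: le_trans (_ : _ <= _) (eq_ind _ (fun t => _ <= t) (lexx _) _ h).
rewrite (bigD1 j)//= !mxE -normCK lerDl.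
by apply: sumr_ge0 => k _; rewrite !mxE -normCK exprn_ge0.
Qed.

End matrix_norm.

(** The entries of a unitary matrix have real and imaginary parts at most 1.
    The summand 1 makes the bound at least 1, so that it can be enlarged to its
    powers, also for n = 0. *)
HB.lock Definition ubound (R : realType) (n : nat) : R := n%:R * n%:R * 2 + 1.

Lemma ubound_ge1 (R : realType) n : 1 <= ubound R n.
Proof. by rewrite ubound.unlock lerDr !mulr_ge0. Qed.

Lemma mnorm_unitary (R : realType) n (M : 'M[R[i]]_n) :
  M \is unitarymx -> mnorm M <= ubound R n.
Proof.
move=> uM; apply: (@le_trans _ _ (n%:R * n%:R * 2)); last by rewrite ubound.unlock lerDl.
by apply: mnorm_le => i j; apply/cabs_le2/unitary_entry_le1.
Qed.

(** * Distance to the identity in the special unitary group *)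

Section deviation.
Context (R : realType) (n : nat).
Local Notation G := (SU R n).
Local Notation U := (ubound R n).
Implicit Types g h x y u : G.

Lemma SU_valM g h : SU_val (g * h)%g = SU_val g *m SU_val h.
Proof. by []. Qed.

Lemma SU_val1 : SU_val (1%g : G) = 1%:M.
Proof. by []. Qed.

Lemma SU_valV g : SU_val (g^-1)%g = (SU_val g)^t*.
Proof. by rewrite -invmx_unitary ?SU_unitary. Qed.

Lemma mnorm_SU g : mnorm (SU_val g) <= U.
Proof. by rewrite mnorm_unitary ?SU_unitary. Qed.

Lemma ubound_gt0 : 0 < U.
Proof. exact: lt_le_trans (ubound_ge1 R n). Qed.

Lemma mnorm_SUMl g m (M : 'M[R[i]]_(n, m)) : mnorm (SU_val g *m M) <= U * mnorm M.
Proof. by rewrite (le_trans (mnormM _ _))// ler_wpM2r ?mnorm_ge0 ?mnorm_SU. Qed.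

Lemma mnorm_SUMr g m (M : 'M[R[i]]_(m, n)) : mnorm (M *m SU_val g) <= mnorm M * U.
Proof. by rewrite (le_trans (mnormM _ _))// ler_wpM2l ?mnorm_ge0 ?mnorm_SU. Qed.

Definition dev g : R := mnorm (SU_val g - 1%:M).

Lemma dev_ge0 g : 0 <= dev g. Proof. exact: mnorm_ge0. Qed.

Lemma dev1 : dev 1%g = 0.
Proof.
rewrite /dev subrr /mnorm big1// => i _.
by rewrite big1// => j _; rewrite mxE cabs0.
Qed.

Lemma devM g h : dev (g * h)%g <= dev g + U * dev h.
Proof.
rewrite /dev; have -> : SU_val (g * h)%g - 1%:M =
    (SU_val g - 1%:M) + SU_val g *m (SU_val h - 1%:M).
  by rewrite SU_valM mulmxBr mulmx1 [RHS]addrC subrKA.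
by rewrite (le_trans (mnormD _ _))// lerD2l mnorm_SUMl.
Qed.

Lemma devV g : dev (g^-1)%g = dev g.
Proof.
rewrite /dev SU_valV -[RHS]mnorm_trC; congr mnorm.
by rewrite linearB /= map_mxB /= trmx1 map_mx1.
Qed.

Lemma dev_ldiv_le g h : dev (g^-1 * h)%g <= U * mnorm (SU_val h - SU_val g).
Proof.
rewrite /dev; have -> : SU_val (g^-1 * h)%g - 1%:M =
    SU_val (g^-1)%g *m (SU_val h - SU_val g).
  by rewrite mulmxBr -!SU_valM mulVg.
exact: mnorm_SUMl.
Qed.

Lemma mnormB_le_dev g h : mnorm (SU_val h - SU_val g) <= U * dev (g^-1 * h)%g.
Proof.
have -> : SU_val h - SU_val g = SU_val g *m (SU_val (g^-1 * h)%g - 1%:M).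
  by rewrite mulmxBr -SU_valM mulVKg mulmx1.
exact: mnorm_SUMl.
Qed.

Lemma mnormB_dev g h : mnorm (SU_val h - SU_val g) <= dev g + dev h.
Proof.
have -> : SU_val h - SU_val g = (SU_val h - 1%:M) - (SU_val g - 1%:M).
  by rewrite opprB addrA subrK.
by rewrite [leRHS]addrC mnormB.
Qed.

Lemma devJ u x : dev (u^-1 * x * u)%g <= U * U * dev x.
Proof.
rewrite /dev; have -> : SU_val (u^-1 * x * u)%g - 1%:M =
    SU_val (u^-1)%g *m (SU_val x - 1%:M) *m SU_val u.
  by rewrite mulmxBr mulmxBl mulmx1 -!SU_valM mulVg.
apply: (le_trans (mnorm_SUMr _ _)); rewrite [leLHS]mulrC -mulrA.
by rewrite ler_wpM2l ?(ltW ubound_gt0)// mnorm_SUMl.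
Qed.

Lemma dev_le g : dev g <= U *+ 2.
Proof.
rewrite (le_trans (mnormB _ _))// mulr2n lerD ?mnorm_SU//.
exact: (mnorm_SU 1%g).
Qed.

(** From [g ^+ k.+1 - h ^+ k.+1 = g (g ^+ k - h ^+ k) + (g - h) h ^+ k]. *)
Lemma expg_sub g h k :
  mnorm (SU_val (g ^+ k)%g - SU_val (h ^+ k)%g)
    <= k%:R * U ^+ k * mnorm (SU_val g - SU_val h).
Proof.
elim: k => [|k IH].
  by rewrite !expg0 !mul0r; rewrite le_eqVlt [mnorm _]dev1 eqxx.
rewrite !expgS !SU_valM.
have -> : SU_val g *m SU_val (g ^+ k)%g - SU_val h *m SU_val (h ^+ k)%g =
    SU_val g *m (SU_val (g ^+ k)%g - SU_val (h ^+ k)%g)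
    + (SU_val g - SU_val h) *m SU_val (h ^+ k)%g.
  by rewrite mulmxBr mulmxBl addrA subrK.
rewrite (le_trans (mnormD _ _))//.
have d0 := mnorm_ge0 (SU_val g - SU_val h).
apply: (@le_trans _ _ (U * (k%:R * U ^+ k * mnorm (SU_val g - SU_val h))
   + mnorm (SU_val g - SU_val h) * U)).
  rewrite lerD ?mnorm_SUMr// (le_trans (mnorm_SUMl _ _))// ler_wpM2l// ltW//.
  exact: ubound_gt0.
have UU : U <= U ^+ k.+1 by rewrite ler_eXnr// ubound_ge1.
rewrite -[k.+1%:R]natr1 mulrDl mul1r mulrDl lerD//.
  by rewrite exprS le_eqVlt; apply/orP; left; apply/eqP; ring.
by rewrite mulrC ler_wpM2r.
Qed.

Lemma SU_sub1_unitary g : let X := SU_val g - 1%:M in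
  X = - (X ^t*) - X *m X ^t*.
Proof.
move=> X; have := SU_unitary g => /unitarymxP.
have -> : SU_val g = X + 1%:M by rewrite subrK.
rewrite linearD /= map_mxD /= trmx1 map_mx1 mulmxDl mul1mx mulmxDr mulmx1.
move=> h; apply/eqP; rewrite -subr_eq0 opprB opprK; apply/eqP.
apply: (addrI (1%:M : 'M[R[i]]_n)); rewrite addr0 -[RHS]h.
by rewrite addrC [X *m _ + X]addrC -!addrA; congr (_ + (_ + _)).
Qed.

(** Half of the entries determine a unitary matrix near the identity.  Put
    [X = x^-1 y - 1].  Then [X = (y - x) - (x - 1) X], so that on [L] the entries
    of [X] are those of [y - x] up to a second-order term.  The relation
    [X = - X^t* - X X^t*] transfers this to the remaining entries, whose
    transposes are in [L].  As [x] and [y] are near the identity, the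
    second-order terms are absorbed in the left-hand side. *)
Lemma dev_le_half (L : rel 'I_n) x y (d e : R) :
  (forall i j, L i j || L j i) -> 0 <= e -> 8 * U * d <= 1 ->
  dev x <= d -> dev y <= d ->
  (forall i j, L i j -> cabs (SU_val y i j - SU_val x i j) <= e) ->
  dev (x^-1 * y)%g <= 4 * (n%:R * n%:R * e).
Proof.
move=> Ltot e0 d1 xd yd xye.
set t := dev _; pose X : 'M[R[i]]_n := SU_val (x^-1 * y)%g - 1%:M.
have t0 : 0 <= t by exact: dev_ge0.
have U1 := ubound_ge1 R n.
have d0 : 0 <= d by exact: le_trans (dev_ge0 x) xd.
have td : t <= U * (d + d).
  rewrite (le_trans (dev_ldiv_le _ _))// ler_wpM2l ?(ltW ubound_gt0)//.
  by rewrite (le_trans (mnormB_dev _ _))// lerD.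
pose Y : 'M[R[i]]_n := (SU_val x - 1%:M) *m X.
have XE : X = (SU_val y - SU_val x) - Y.
  rewrite /Y mulmxBl mul1mx opprB addrC -addrA.
  by rewrite [- _ + _]addrC /X mulmxBr -SU_valM mulVKg mulmx1 subrr addr0.
have XW := SU_sub1_unitary (x^-1 * y)%g; rewrite -/X /= in XW.
pose W : 'M[R[i]]_n := X *m X ^t*.
have LX i j : L i j -> cabs (X i j) <= e + cabs (Y i j).
  move=> Lij; rewrite XE mxE (le_trans (cabsD _ _))// [(- Y) i j]mxE cabsN.
  by rewrite lerD2r mxE [(- SU_val x) i j]mxE xye.
have tY : mnorm Y <= d * t.
  rewrite (le_trans (mnormM _ _))// ler_wpM2r//.
have tW : mnorm W <= t * t.
  by rewrite (le_trans (mnormM _ _))// mnorm_trC.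
have tX : t = mnorm X by [].
rewrite -/W in XW; clearbody t X Y W.
have Xij i j : cabs (X i j) <= e + cabs (Y i j) + (e + cabs (Y j i)) + cabs (W i j).
  have aY k l := cabs_ge0 (Y k l); have aW := cabs_ge0 (W i j).
  have [Lij|Lji] := orP (Ltot i j).

    by have := LX _ _ Lij; have := aY j i; lra.
  rewrite XW mxE (le_trans (cabsD _ _))// [(- W) i j]mxE cabsN lerD2r.
  rewrite !mxE cabsN -[in X in X <= _]/(_^*)%C cabs_conj.
  by have := LX _ _ Lji; have := aY i j; lra.
have tS : t <= 2 * (n%:R * n%:R * e) + 2 * mnorm Y + mnorm W.
  have -> : 2 * (n%:R * n%:R * e) + 2 * mnorm Y + mnorm W =
      \sum_i \sum_j (e + cabs (Y i j) + (e + cabs (Y j i)) + cabs (W i j)).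
    under eq_bigr do rewrite !big_split /=.
    rewrite !big_split /= [X in _ = _ + (_ + X) + _]exchange_big /=.
    rewrite !sumr_const !card_ord -mulrnA -[e *+ _]mulr_natl natrM.
    rewrite /mnorm; ring.
  by rewrite tX; apply: ler_sum => i _; apply: ler_sum => j _.
have tt2 : t * t <= U * (d + d) * t by rewrite ler_wpM2r.
have Ud : d * t <= U * d * t.
  by rewrite -mulrA ler_peMl// mulr_ge0.
have : 8 * U * d * t <= 1 * t by rewrite ler_wpM2r.
lra.
Qed.

End deviation.

(** * Nets, packings and the Haar mass of balls *)

(** Cut the cube of side [2 * L] that contains the coordinates into boxes of
    side [e], and keep one point of [S] in each box that meets [S]. *)
Lemma finite_net (R : realType) (T : eqType) (I : finType) (F : I -> T -> R)
    (S : set T) (L e : R) (q : nat) : 0 < e ->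
    (forall x k, S x -> `|F k x| <= L) -> 2 * L < q.+1%:R * e ->
  exists s : seq T, [/\ (size s <= q.+1 ^ #|I|)%N, (forall x, x \in s -> S x) &
    forall x, S x -> exists2 y, y \in s & forall k, `|F k x - F k y| <= e].
Proof.
move=> e0 FL Lq.
pose pos k x := (F k x + L) / e.
have pos_ge0 x k : S x -> 0 <= pos k x.
  by move=> /FL-/(_ k) /ler_normlP[] h _; rewrite divr_ge0 ?(ltW e0)//; lra.
pose cell x : {ffun I -> 'I_q.+1} := [ffun k => inord (Num.truncn (pos k x))].
have cellE x k : S x -> cell x k = Num.truncn (pos k x) :> nat.
  move=> Sx; rewrite ffunE inordK// -(ltr_nat R).
  rewrite (le_lt_trans (y := pos k x)) ?truncn_le ?pos_ge0//.
  rewrite ltr_pdivrMr//; move: (FL x k Sx) => /ler_normlP[_ h]; lra.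
have rep (c : {ffun I -> 'I_q.+1}) : {o : option T |
    (forall x, o = Some x -> S x /\ cell x = c) /\
    (o = None -> forall x, S x -> cell x <> c)}.
  case: (pselect (exists x, S x /\ cell x = c)) => [/cid[x xc]|nc].
    by exists (Some x); split => // y [<-].
  by exists None; split => // _ x Sx xc; apply: nc; exists x.
exists (pmap (fun c => sval (rep c)) (enum {ffun I -> 'I_q.+1})); split.
- rewrite size_pmap (leq_trans (count_size _ _))// -cardE.
  by rewrite card_ffun card_ord.
- move=> x; rewrite mem_pmap => /mapP[c _]; case: (rep c) => o /= [h _] xo.
  by have [] := h _ (esym xo).
- move=> x Sx; have := erefl (sval (rep (cell x))).
  case: {1}(sval _) => [y|] ry; last first.
    by case: (svalP (rep (cell x))) => _ /(_ (esym ry) x Sx); case.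
  have [Sy yx] := (svalP (rep (cell x))).1 _ (esym ry).
  exists y.
    by rewrite mem_pmap; apply/mapP; exists (cell x); rewrite ?mem_enum.
  move=> k; have : cell y k = cell x k :> nat by rewrite yx.
  rewrite !cellE// => yxk.
  have := truncn_itv (pos_ge0 _ k Sx); have := truncn_itv (pos_ge0 _ k Sy).
  rewrite yxk -natr1; set t := (Num.truncn _)%:R => /andP[y1 y2] /andP[x1 x2].
  have -> : F k x - F k y = (pos k x - pos k y) * e.
    by rewrite -mulrBl divfK ?gt_eqF//; ring.
  rewrite normrM (gtr0_norm e0) ler_piMl ?(ltW e0)// ler_norml.
  by apply/andP; split; lra.
Qed.

(** Provides the maximal packings. *)
Lemma max_seq (T : Type) (P : seq T -> Prop) (b : nat) :
    P [::] -> (forall s, P s -> (size s <= b)%N) ->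
  exists2 s, P s & forall s', P s' -> (size s' <= size s)%N.
Proof.
move=> P0 Pb; pose Q k := `[< exists2 s, P s & size s = k >].
have Q0 : exists k, Q k by exists 0%N; apply/asboolP; exists [::].
have Qb k : Q k -> (k <= b)%N by move/asboolP => [s /Pb + <-].
case: (ex_maxnP Q0 Qb) => k /asboolP[s Ps <-] smax; exists s => // s' Ps'.
by apply: smax; apply/asboolP; exists s'.
Qed.

Section haar_mass.
Context (R : realType) (n : nat) (mu : probability (SU R n) R).
Context (mu_haar : is_Haar mu).
Local Notation G := (SU R n).
Local Notation U := (ubound R n).
Implicit Types (g h : G) (r : R) (A B : set G) (s : seq G).

(** The left translate of the ball around the identity: left-invariant, which
    the norm of [g - h] is only up to a constant. *)
Definition nbd h r : set G := [set g | dev (h^-1 * g)%g < r].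

Lemma measurable_dev : measurable_fun setT (@dev R n).
Proof.
rewrite (_ : @dev R n = fun g => \sum_i \sum_j
   (`|complex.Re (SU_val g i j) - complex.Re ((1%:M : 'M[R[i]]_n) i j)| +
    `|complex.Im (SU_val g i j) - complex.Im ((1%:M : 'M[R[i]]_n) i j)|)).
  apply: measurable_sum => i; apply: measurable_sum => j.
  apply: measurable_funD; apply: (measurableT_comp (@normr_measurable R setT)) => //;
  apply: measurable_funB => //; [exact: measurable_SU_Re|exact: measurable_SU_Im].
apply/funext => g; do 2![apply: eq_bigr => ? _]; rewrite cabsE [(SU_val g - _) _ _]mxE.
by rewrite [(- 1%:M) _ _]mxE !raddfB.
Qed.

Lemma measurable_SU_mull h : measurable_fun setT (fun g : G => (h * g)%g).
Proof.
rewrite (_ : (fun _ => _) = (fun p : G * G => (p.1 * p.2)%g) \o (fun g => (h, g)))//.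
by apply: measurableT_comp; [exact: measurable_SU_mul|exact: measurable_fun_pair].
Qed.

Lemma measurable_nbd h r : measurable (nbd h r).
Proof.
have m : measurable_fun setT (fun g => dev (h^-1 * g)%g).
  exact: measurableT_comp measurable_dev (measurable_SU_mull _).
rewrite (_ : nbd h r = setT `&` (fun g => dev (h^-1 * g)%g) @^-1` `]-oo, r[%classic).
  exact: m measurableT _ (measurable_itv _).
by rewrite setTI; apply/seteqP; split => t /=; rewrite in_itv.
Qed.
Hint Resolve measurable_nbd : core.

Lemma nbd_translate h r : nbd h r = [set (h * x)%g | x in nbd 1%g r].
Proof.
apply/seteqP; split => [g hg|_ [x + <-]]; last by rewrite /nbd /= invg1 mul1g mulKg.
by exists (h^-1 * g)%g; rewrite ?mulVKg//= /nbd /= invg1 mul1g.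
Qed.

Lemma in_nbd h r : 0 < r -> nbd h r h.
Proof. by move=> r0; rewrite /nbd /= mulVg dev1. Qed.

Lemma dev_common (g h x : G) r :
  nbd g r x -> nbd h r x -> dev (h^-1 * g)%g <= r + U * r.
Proof.
move=> gx hx; have -> : (h^-1 * g = (h^-1 * x) * (g^-1 * x)^-1)%g.
  by rewrite invgM invgK mulgA mulgK.
apply: (le_trans (devM _ _)); apply: lerD; first exact: (ltW hx).
apply: ler_wpM2l; first exact: ltW (ubound_gt0 R n).
by rewrite devV; exact: (ltW gx).
Qed.

Definition mass A : R := fine (mu A).

Lemma massE A : measurable A -> mu A = (mass A)%:E.
Proof. by move=> mA; rewrite /mass fineK// fin_num_measure. Qed.

Lemma mass_ge0 A : 0 <= mass A.
Proof. by rewrite fine_ge0. Qed.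

Lemma massS A B : measurable A -> measurable B -> A `<=` B -> mass A <= mass B.
Proof. by move=> mA mB AB; rewrite -lee_fin -!massE// le_measure// inE. Qed.

Lemma massT : mass setT = 1.
Proof. by rewrite /mass probability_setT. Qed.

Definition bmass r := mass (nbd 1%g r).

Lemma mass_nbd h r : mass (nbd h r) = bmass r.
Proof. by rewrite /mass nbd_translate mu_haar. Qed.

Let union s r := \big[setU/set0]_(h <- s) nbd h r.

Let measurable_union s r : measurable (union s r).
Proof. exact: bigsetU_measurable. Qed.

Lemma mass_cover A s r : measurable A ->
  (forall g, A g -> exists2 h, h \in s & nbd h r g) -> mass A <= (size s)%:R * bmass r.
Proof.
move=> mA As; apply: (@le_trans _ _ (mass (union s r))).
  apply: massS => // g /As[h hs hg].
  by rewrite /union -bigcup_seq; exists h.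
elim: s {As} => [|h s IH]; first by rewrite /union big_nil /mass measure0 mul0r.
rewrite /union big_cons -/(union s r) /= -natr1 mulrDl mul1r addrC.
rewrite -lee_fin -massE; last exact: measurableU.
apply: (@le_trans _ _ ((mass (nbd h r))%:E + (mass (union s r))%:E)%E).
  by rewrite -!massE//; exact: measureU2.
by rewrite -EFinD lee_fin mass_nbd lerD2l.
Qed.

Lemma mass_pack A s r : measurable A -> (forall h, h \in s -> nbd h r `<=` A) ->
    pairwise (fun g h => `[< nbd g r `&` nbd h r = set0 >]) s ->
  (size s)%:R * bmass r <= mass A.
Proof.
move=> mA sA ps; apply: (@le_trans _ _ (mass (union s r))); last first.
  apply: massS => // g; rewrite /union -bigcup_seq => -[h hs]; exact: sA.
elim: s ps {sA} => [_|h s IH]; first by rewrite mul0r mass_ge0.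
rewrite pairwise_cons => /andP[/allP hs /IH{}IH].
rewrite /union big_cons -/(union s r) /= -natr1 mulrDl mul1r addrC.
rewrite -lee_fin -massE; last exact: measurableU.
have -> : mu (nbd h r `|` union s r) =
    ((mass (nbd h r))%:E + (mass (union s r))%:E)%E.
  rewrite -!massE//; apply: measureU => //.
  rewrite /union -bigcup_seq setI_bigcupr bigcup0// => g /= gs.
  exact/asboolP/hs.
by rewrite -EFinD lee_fin mass_nbd lerD2l.
Qed.

End haar_mass.

(** * Lower bound for the mass of approximate roots of the identity *)

Section ball_growth.
Context (R : realType) (n : nat).
Local Notation G := (SU R n).
Local Notation U := (ubound R n).

Lemma cabs_coord_le (z w : R[i]) (e : R) :
  (forall b : bool, `|(if b then complex.Re z else complex.Im z) -
     (if b then complex.Re w else complex.Im w)| <= e) -> cabs (z - w) <= 2 * e.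
Proof.
move=> h; rewrite cabsE !raddfB/=.
by have := h true; have := h false; lra.
Qed.

Lemma coord_le_cabs (z : R[i]) (b : bool) :
  `|if b then complex.Re z else complex.Im z| <= cabs z.
Proof. by rewrite cabsE; case: b; rewrite ?lerDl ?lerDr. Qed.

(** The number of balls does not depend on [r], since the matrix entries vary in
    an interval of length proportional to [r] in the large ball. *)
Lemma ball_net (c : R) : 0 < c ->
  exists K : nat, forall r : R, 0 < r -> exists2 s : seq G, (size s <= K)%N &
    forall g, nbd 1%g (c * r) g -> exists2 h, h \in s & nbd h r g.
Proof.
move=> c0; set q := Num.truncn (4 * c * U * U).
have U0 := ubound_gt0 R n.
exists (q.+1 ^ #|{: 'I_n * 'I_n * bool}|)%N => r r0.
pose F (k : 'I_n * 'I_n * bool) (g : G) := let z := (SU_val g - 1%:M) k.1.1 k.1.2 in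
  if k.2 then complex.Re z else complex.Im z.
pose e := r / (2 * U * U).
have e0 : 0 < e by rewrite divr_gt0// !mulr_gt0.
have eU : U * U * e = r / 2 by rewrite /e; field; rewrite gt_eqF.
have [||s [ss _ sF]] := @finite_net R G _ F (nbd 1%g (c * r)) (c * r) e q e0.
- move=> x k; rewrite /nbd /= invg1 mul1g => xr.
  rewrite (le_trans (coord_le_cabs _ _))// (le_trans (cabs_le_mnorm _ _ _))//.
  exact: ltW.
- have h : 4 * c * U * U < q.+1%:R by rewrite truncnS_gt.
  have -> : 2 * (c * r) = 4 * c * U * U * e by rewrite -[_ * U * U]mulrA -mulrA eU; field.
  by rewrite ltr_pM2r.
exists s => // g /sF[h hs hF]; exists h => //; rewrite /nbd /=.
apply: (le_lt_trans (dev_ldiv_le _ _)).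
have : mnorm (SU_val g - SU_val h) <= U * e.
  rewrite ubound.unlock mulrDl mul1r.
  apply: (@le_trans _ _ (n%:R * n%:R * (2 * e))).
    apply: mnorm_le => i j.
    have -> : (SU_val g - SU_val h) i j =
        (SU_val g - 1%:M) i j - (SU_val h - 1%:M) i j.
      by rewrite !mxE; ring.
    by apply: cabs_coord_le => b; exact: (hF (i, j, b)).
  by rewrite [leLHS]mulrA lerDl ltW.
move=> h1; apply: (@le_lt_trans _ _ (U * (U * e))); first by rewrite ler_wpM2l// ltW.
by rewrite mulrA eU ltr_pdivrMr// ltr_pMr// ltr1n.
Qed.

Context (mu : probability G R) (mu_haar : is_Haar mu).

Lemma bmass_doubling (c : R) : 0 < c ->
  exists2 K : R, 0 < K & forall r, 0 < r -> bmass mu (c * r) <= K * bmass mu r.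
Proof.
move=> c0; have [K hK] := ball_net c0; exists K.+1%:R => // r r0.
have [s sK hs] := hK r r0.
apply: (le_trans (mass_cover mu_haar (measurable_nbd _ _) hs)).
by rewrite ler_wpM2r ?mass_ge0// ler_nat ltnW.
Qed.

(** SU_n is itself a ball, of radius [4 * U], hence covered by finitely many
    balls of radius [r]. *)
Lemma bmass_gt0 r : 0 < r -> 0 < bmass mu r.
Proof.
move=> r0; have U0 := ubound_gt0 R n.
have [|K K0 hK] := @bmass_doubling (4 * U / r); first by rewrite divr_gt0// mulr_gt0.
have := hK r r0; rewrite divfK ?gt_eqF// (_ : bmass mu (4 * U) = 1); last first.
  transitivity (mass mu setT); last exact: massT.
  congr mass; apply/seteqP; split => // g _.
  rewrite /nbd /= invg1 mul1g (le_lt_trans (dev_le _))// mulr2n; lra.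
move=> h; rewrite -(pmulr_rgt0 _ K0); lra.
Qed.

End ball_growth.

Section power_fibre.
Context (R : realType) (n : nat) (mu : probability (SU R n) R).
Context (mu_haar : is_Haar mu) (l : nat).
Local Notation G := (SU R n).
Local Notation U := (ubound R n).

Definition near_roots r : set G := [set g | dev (g ^+ l)%g < r].

Lemma measurable_near_roots r : measurable (near_roots r).
Proof.
have m : measurable_fun setT (fun g : G => dev (g ^+ l)%g).
  exact: measurableT_comp (@measurable_dev R n) (@measurable_SU_expg R n l).
rewrite (_ : near_roots r = setT `&` (fun g => dev (g ^+ l)%g) @^-1` `]-oo, r[%classic).
  exact: m measurableT _ (measurable_itv _).
by rewrite setTI; apply/seteqP; split => t /=; rewrite in_itv.
Qed.

Context (d : 'rV[R[i]]_n) (D : G).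
Context (DE : SU_val D = diag_mx d) (Dl : (D ^+ l)%g = 1%g).

(** The entries on and below the diagonal in the diagonal blocks of a matrix
    that commutes with [D]; twice their number bounds the dimension of the
    centralizer of [D]. *)
Definition block_pairs : {pred 'I_n * 'I_n} :=
  [pred ij | (d 0 ij.1 == d 0 ij.2) && (ij.2 <= ij.1)%N].

(** [Gam] bounds the inverses of all the eigenvalue gaps at once; the inverse of
    a zero gap is 0. *)
Let Gam := \sum_i \sum_j cabs (d 0 j - d 0 i)^-1.

(** The [(i, j)] entry of [v D - D v] is [v i j * (d j - d i)]. *)
Lemma off_block_le (v : G) i j : d 0 i != d 0 j ->
  cabs (SU_val v i j) <= Gam * mnorm (SU_val (v * D)%g - SU_val (D * v)%g).
Proof.
move=> dij; have dji : d 0 j - d 0 i != 0 by rewrite subr_eq0 eq_sym.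
have h : (SU_val (v * D)%g - SU_val (D * v)%g) i j * (d 0 j - d 0 i)^-1 = SU_val v i j.
  rewrite !SU_valM DE mxE [(- (_ *m _)) i j]mxE mul_mx_diag mul_diag_mx !mxE.
  by rewrite [d 0 i * _]mulrC -mulrBr mulfK.
rewrite -h (le_trans (cabsM _ _))// mulrC ler_pM ?cabs_ge0 ?cabs_le_mnorm//.
rewrite /Gam (bigD1 i)//= (bigD1 j)//= -addrA lerDl addr_ge0//.
  by apply: sumr_ge0 => ? _; exact: cabs_ge0.
by apply: sumr_ge0 => ? _; apply: sumr_ge0 => ? _; exact: cabs_ge0.
Qed.

Lemma Gam_ge0 : 0 <= Gam.
Proof. by apply: sumr_ge0 => ? _; apply: sumr_ge0 => ? _; exact: cabs_ge0. Qed.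

Let tube C r : set G := [set v | 8 * U * dev v <= 1 /\
  mnorm (SU_val (v * D)%g - SU_val (D * v)%g) <= C * r].

(** Only the [block_pairs] are subdivided.  The entries off the diagonal blocks
    are already of order [r] in the tube, and [dev_le_half] handles those above
    the diagonal. *)
Lemma tube_net (C : R) : 0 < C -> exists C' K : R, [/\ 0 < C', 0 < K &
  forall r, 0 < r -> r <= 1 -> exists2 s : seq G,
    (size s)%:R * r ^+ (#|block_pairs| * 2) <= K &
    forall v, tube C r v -> exists2 h, h \in s & nbd h (C' * r) v].
Proof.
move=> C0; have U0 := ubound_gt0 R n.
pose e := 2 + 2 * Gam * C.
have GC0 : 0 <= 2 * Gam * C by rewrite !mulr_ge0 ?Gam_ge0// ltW.
have e2 : 2 <= e by rewrite /e lerDl.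
have eG : 2 * Gam * C <= e by rewrite /e lerDr.
have e0 : 0 < e by exact: lt_le_trans e2.
clearbody e.
exists (4 * (n%:R * n%:R * e) + 1), ((2 * U + 1) ^+ (#|block_pairs| * 2)).
have C'0 : 0 < 4 * (n%:R * n%:R * e) + 1.
  by rewrite ltr_wpDl// !mulr_ge0// ltW.
split=> // [|r r0 r1]; first by rewrite exprn_gt0// addr_gt0// mulr_gt0.
set q := Num.truncn (2 * U / r).
pose I := ({ij | ij \in block_pairs} * bool)%type.
pose F (k : I) (g : G) := let z := SU_val g (val k.1).1 (val k.1).2 in
  if k.2 then complex.Re z else complex.Im z.
have [||s [ss sV sF]] := @finite_net R G _ F (tube C r) U r q r0.
- move=> x k _; rewrite (le_trans (coord_le_cabs _ _))//.
  by rewrite (le_trans (cabs_le_mnorm _ _ _))// mnorm_SU.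
- by rewrite -ltr_pdivrMr// truncnS_gt.
exists s.
  have qr : q.+1%:R * r <= 2 * U + 1.
    rewrite -natr1 mulrDl mul1r lerD// -ler_pdivlMr// truncn_le//.
    by rewrite divr_ge0// ?mulr_ge0// ltW.
  have : (size s)%:R <= q.+1%:R ^+ (#|block_pairs| * 2) :> R.
    by rewrite -natrX ler_nat (leq_trans ss)// card_prod card_bool card_sig.
  move=> h; apply: (@le_trans _ _
    (q.+1%:R ^+ (#|block_pairs| * 2) * r ^+ (#|block_pairs| * 2))).
    by rewrite ler_wpM2r// exprn_ge0// ltW.
  rewrite -exprMn lerXn2r ?nnegrE//; first by rewrite mulr_ge0// ltW.
  by rewrite addr_ge0// mulr_ge0// ltW.
move=> v vV; have [h hs hF] := sF v vV; exists h => //.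
have {}hV := sV h hs.
pose L i j := (d 0 i != d 0 j) || (j <= i)%N.
have Ltot i j : L i j || L j i.
  by rewrite /L; case: eqVneq => //= _; exact: leq_total.
have U8 : 8 * U * (1 / (8 * U)) <= 1.
  by rewrite mul1r divff// gt_eqF// mulr_gt0.
have dV w : tube C r w -> dev w <= 1 / (8 * U).
  by case=> wd _; rewrite ler_pdivlMr ?mulr_gt0// mulrC.
rewrite /nbd /=; apply: le_lt_trans
  (dev_le_half (e := e * r) Ltot _ U8 (dV _ hV) (dV _ vV) _) _.
- by rewrite mulr_ge0// ltW.
- move=> i j; rewrite /L; case: eqVneq => [dij /= ji|dij _].
    apply: (@le_trans _ _ (2 * r)); last first.
      by rewrite ler_wpM2r ?(ltW r0).
    have ijb : (i, j) \in block_pairs by rewrite inE /= dij eqxx.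
    by apply: cabs_coord_le => b; exact: (hF (exist _ (i, j) ijb, b)).
  rewrite (le_trans (cabsD _ _))// cabsN.
  apply: (@le_trans _ _ (Gam * (C * r) + Gam * (C * r))).
    by rewrite lerD// (le_trans (off_block_le _ dij))// ler_wpM2l ?Gam_ge0//;
      [exact: vV.2|exact: hV.2].
  have := ler_wpM2r (ltW r0) eG; lra.
rewrite [ltRHS](_ : _ = 4 * (n%:R * n%:R * (e * r)) + r) ?ltrDl//; ring.
Qed.

Let conjD (u : G) : G := (D ^ u^-1)%g.

(** The commutator of [D] and [u'^-1 * u] is a conjugate of the quotient of the
    two conjugates of [D]. *)
Lemma near_conj_tube (u u' : G) r :
  16 * U * U * dev u <= 1 -> 16 * U * U * dev u' <= 1 ->
  nbd (conjD u) r `&` nbd (conjD u') r !=set0 ->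
  tube (2 * U ^+ 4) r (u'^-1 * u)%g.
Proof.
move=> du du' [x [xu xu']]; have U0 := ubound_gt0 R n; have U1 := ubound_ge1 R n.
have r0 : 0 <= r by rewrite (le_trans (dev_ge0 _) (ltW xu)).
split.
  have h : dev (u'^-1 * u)%g <= U * (dev u' + dev u).
    by rewrite (le_trans (dev_ldiv_le _ _))// ler_wpM2l ?(ltW U0)// mnormB_dev.
  have := ler_wpM2l (ltW U0) h; lra.
set v := (u'^-1 * u)%g.
apply: (le_trans (mnormB_le_dev _ _)).
have -> : ((D * v)^-1 * (v * D) = u^-1 * ((conjD u')^-1 * conjD u) * u)%g.
  by rewrite /conjD /v !conjgE !invgM !invgK !mulgA mulgVK.
have h : dev ((conjD u')^-1 * conjD u)%g <= r + U * r.
  exact: dev_common xu xu'.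
have {}h : dev ((conjD u')^-1 * conjD u)%g <= 2 * U * r.
  by have := ler_wpM2r r0 U1; lra.
have /(ler_wpM2l (ltW U0)) := devJ u ((conjD u')^-1 * conjD u)%g.
have UUU : 0 <= U * U * U by rewrite !mulr_ge0// ltW.
by have := ler_wpM2l UUU h; lra.
Qed.

(** Choose a maximal family of [u] near the identity such that the balls of
    radius [r] centred at the [u D u^-1] are disjoint.  By maximality the
    translates by these [u] of a tube cover a fixed ball, whose mass is a
    positive constant; as the tube is covered by at most a multiple of
    [r ^- (#|block_pairs| * 2)] balls of radius proportional to [r], the total
    mass of the disjoint balls is at least a multiple of
    [r ^+ (#|block_pairs| * 2)].  They are all contained in
    [near_roots (C * r)]. *)
Lemma near_roots_mass_ge : exists C K : R, [/\ 0 < C, 0 < K &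
  forall r, 0 < r -> r <= 1 ->
    r ^+ (#|block_pairs| * 2) <= K * mass mu (near_roots (C * r))].
Proof.
have U0 := ubound_gt0 R n; have U1 := ubound_ge1 R n.
have [|C' [K1 [C'0 K10 hK1]]] := @tube_net (2 * U ^+ 4).
  by rewrite mulr_gt0// exprn_gt0.
have [K2 K20 hK2] := bmass_doubling mu_haar C'0.
pose C := l%:R * U ^+ l * U + 1.
have C0 : 0 < C by rewrite ltr_wpDl// !mulr_ge0 ?exprn_ge0// ltW.
pose d0 := 1 / (16 * U * U).
have d00 : 0 < d0 by rewrite divr_gt0// !mulr_gt0.
have b0 := bmass_gt0 mu_haar d00.
exists C, (K1 * K2 / bmass mu d0); split => // [|r r0 r1].
  by rewrite divr_gt0// mulr_gt0.
have near_small (u : G) : nbd 1%g d0 u -> 16 * U * U * dev u <= 1.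
  rewrite /nbd /= invg1 mul1g /d0 => /ltW.
  by rewrite ler_pdivlMr ?mulr_gt0// mulrC.
have nbdP u : nbd (conjD u) r `<=` near_roots (C * r).
  move=> x xu; rewrite /near_roots /=.
  have cl : ((conjD u) ^+ l = 1)%g by rewrite /conjD -conjXg Dl conj1g.
  rewrite /dev -SU_val1 -cl (le_lt_trans (expg_sub _ _ _))//.
  apply: (@le_lt_trans _ _ (l%:R * U ^+ l * (U * r))).
    rewrite ler_wpM2l ?mulr_ge0 ?exprn_ge0 ?(ltW U0)//.
    rewrite (le_trans (mnormB_le_dev _ _))// ler_wpM2l ?(ltW U0)//.
    exact: ltW.
  by rewrite mulrA /C [ltRHS]mulrDl mul1r ltrDl.
pose good (s : seq G) := (forall u, u \in s -> nbd 1%g d0 u) /\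
  pairwise (fun g h => `[< nbd (conjD g) r `&` nbd (conjD h) r = set0 >]) s.
have pack s : good s -> (size s)%:R * bmass mu r <= mass mu (near_roots (C * r)).
  move=> [_ ps]; rewrite -(size_map conjD).
  apply: (mass_pack mu_haar (measurable_near_roots _)).
    by move=> _ /mapP[u _ ->].
  by rewrite pairwise_map.
have br := bmass_gt0 mu_haar r0.
have [||s gs smax] := @max_seq _ good (Num.truncn (1 / bmass mu r)).
- by split.
- move=> s /pack sp; rewrite truncn_ge_nat ?divr_ge0 ?(ltW br)// ler_pdivlMr//.
  rewrite (le_trans sp)// -(massT mu); apply: massS => //.
  exact: measurable_near_roots.
have [t tK ht] := hK1 r r0 r1.
have cov u : nbd 1%g d0 u -> exists2 h, h \in [seq (u * h)%g | u <- s, h <- t] &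
    nbd h (C' * r) u.
  move=> ud.
  (* otherwise [u] could be added to the maximal family *)
  have [u' u's uu'] : exists2 u', u' \in s &
      nbd (conjD u) r `&` nbd (conjD u') r !=set0.
    apply: contrapT => nu; suff /smax : good (u :: s) by rewrite ltnn.
    split; first by move=> h; rewrite inE => /predU1P[->//|]; exact: gs.1.
    rewrite pairwise_cons gs.2 andbT; apply/allP => h hs; apply/asboolP.
    by apply: contrapT => /eqP/set0P uh; apply: nu; exists h.
  have uV := near_conj_tube (near_small _ ud) (near_small _ (gs.1 _ u's)) uu'.
  have [h ht' hu] := ht _ uV; exists (u' * h)%g; first by apply: allpairs_f.
  by rewrite /nbd /= invgM -mulgA.
have := mass_cover mu_haar (measurable_nbd _ _) cov.
rewrite size_allpairs natrM -/(bmass mu d0) => h.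
set M := mass mu _; have := pack _ gs; rewrite -/M => sM.
rewrite mulrAC ler_pdivlMr//.
set rr := r ^+ _.
have rr0 : 0 < rr by rewrite exprn_gt0.
have := hK2 r r0 => h2.
have h3 : rr * bmass mu d0 <=
    rr * ((size s)%:R * (size t)%:R * (K2 * bmass mu r)).
  rewrite ler_wpM2l ?(ltW rr0)// (le_trans h)// ler_wpM2l ?mulr_ge0//.
apply: (le_trans h3).
rewrite [leLHS](_ : _ =
  ((size t)%:R * rr) * (K2 * ((size s)%:R * bmass mu r))); last ring.
rewrite -[leRHS]mulrA ler_pM ?mulr_ge0 ?(ltW rr0) ?(ltW K20) ?(ltW br)//.
by rewrite ler_wpM2l ?(ltW K20).
Qed.

End power_fibre.

(** * Upper bound for the mass of small balls *)

Section cayley.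
Context (R : realType) (n : nat).
Local Notation M := 'M[R[i]]_n.+1.
Implicit Types (A B : M) (P : 'M[R]_n.+1).

Lemma trC_mul m p q (X : 'M[R[i]]_(m, p)) (Y : 'M[R[i]]_(p, q)) :
  (X *m Y)^t* = Y^t* *m X^t*.
Proof. by rewrite trmx_mul map_mxM. Qed.

Lemma trC_add (X Y : M) : (X + Y)^t* = X^t* + Y^t*.
Proof. by rewrite linearD /= map_mxD. Qed.

Lemma trC_opp (X : M) : (- X)^t* = - X^t*.
Proof. by rewrite linearN /= map_mxN. Qed.

Lemma trC_1 : (1 : M)^t* = 1.
Proof. by rewrite trmx1 map_mx1. Qed.

Lemma row_self_dot_eq0 (v : 'rV[R[i]]_n.+1) : v *m v^t* = 0 -> v = 0.
Proof.
move=> /matrixP/(_ 0 0); rewrite !mxE => /eqP; rewrite psumr_eq0; last first.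
  by move=> j _; rewrite !mxE -normCK exprn_ge0.
move=> /allP h; apply/rowP => j; have := h j (mem_index_enum j).
by rewrite !mxE /= -normCK sqrf_eq0 normr_eq0 => /eqP.
Qed.

(** If [v = v A], then the scalar [v v^t* = v A v^t*] is equal to its own adjoint
    and to the opposite of it, so [v = 0]. *)
Lemma one_sub_skew_unit A : A^t* = - A -> (1 - A) \is a GRing.unit.
Proof.
move=> sA; rewrite -[_ \is a _]/((1 - A) \in unitmx) -row_free_unit -kermx_eq0.
apply/eqP/row_matrixP => i; rewrite row0; set v := row i _.
have : v *m (1 - A) = 0 by rewrite -row_mul mulmx_ker row0.
rewrite mulmxBr mulmx1 => /eqP; rewrite subr_eq0 => /eqP vA.
apply: row_self_dot_eq0; set x := v *m _.
have xE : x = v *m A *m v^t* by rewrite -vA.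
have xx : x^t* = x by rewrite trC_mul trmxCK.
have : x^t* = - x.
  by rewrite {1}xE trC_mul trC_mul trmxCK sA xE mulNmx mulmxN mulmxA.
rewrite xx => /eqP; rewrite -subr_eq0 opprK -mulr2n.
by rewrite -scaler_nat scaler_eq0 pnatr_eq0 /= => /eqP.
Qed.

Lemma one_add_skew_unit A : A^t* = - A -> (1 + A) \is a GRing.unit.
Proof.
by move=> sA; rewrite -[A]opprK one_sub_skew_unit// trC_opp sA.
Qed.

Definition cayley A : M := (1 + A) / (1 - A).

Lemma cayley_mulr A : A^t* = - A -> cayley A * (1 - A) = 1 + A.
Proof. by move=> sA; rewrite /cayley divrK// one_sub_skew_unit. Qed.

Lemma comm_cayley A : GRing.comm (1 + A) (1 - A).
Proof.
apply: commrB; first exact: commr1.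
by apply: commr_sym; apply: commrD; [exact: commr1|exact: commr_refl].
Qed.

Lemma cayley_mull A : A^t* = - A -> (1 - A) * cayley A = 1 + A.
Proof.
move=> sA; rewrite /cayley mulrA -comm_cayley -mulrA divrr ?mulr1//.
exact: one_sub_skew_unit.
Qed.

Lemma cayley_unitary A : A^t* = - A -> cayley A \is unitarymx.
Proof.
move=> sA; apply/unitarymxP.
have h : (1 + A) *m (cayley A)^t* = 1 - A.
  have := congr1 (fun X : M => X^t*) (cayley_mulr sA).
  rewrite /= -[_ * _]/(_ *m _) trC_mul !trC_add trC_opp trC_1 sA opprK.
  by [].
have c : GRing.comm (1 + A) (cayley A).
  apply: commrM; first exact: commr_refl.
  by apply: commrV; exact: comm_cayley.
apply: (mulrI (one_add_skew_unit sA)).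
rewrite -[_ *m _]/(_ * _) mulrA c -mulrA [X in _ * X]h.
by rewrite cayley_mulr// mulr1.
Qed.

(** This inverts the Cayley transform at the level of quotients: it recovers
    [A - B] from [w = (cayley B)^-1 * cayley A], with bounded factors. *)
Lemma cayley_diff A B (w : M) : A^t* = - A -> B^t* = - B ->
  cayley B * w = cayley A -> (1 + B) * (w - 1) * (1 - A) = (A - B) *+ 2.
Proof.
move=> sA sB wE.
have -> : (1 + B) * (w - 1) = (1 - B) * (cayley A - cayley B).
  by rewrite -(cayley_mull sB) -mulrA [X in _ * X]mulrBr mulr1 wE.
rewrite -mulrA [X in _ * X]mulrBl cayley_mulr// mulrBr [X in _ - X]mulrA cayley_mull//.
have -> : (1 - B) * (1 + A) = 1 + A - B - B * A.
  by rewrite mulrDr mulr1 mulrBl mul1r addrA [1 + A - B]addrAC.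
have -> : (1 + B) * (1 - A) = 1 - A + B - B * A.
  by rewrite mulrBr mulr1 mulrDl mul1r opprD addrA [1 - A + B]addrAC.
move: (B * A) => BA; apply/matrixP => i j.
by rewrite mulr2n; move: (1 : M) => I1; rewrite !mxE; ring.
Qed.

(** Encodes a real matrix without constraint as a skew-Hermitian one: [P i j] is
    half the sum of the real and imaginary parts of the [(i, j)] entry. *)
Definition skew_of P : M :=
  \matrix_(i, j) ((P i j - P j i) +i* (P i j + P j i))%C.

Lemma skew_ofP P : (skew_of P)^t* = - skew_of P.
Proof.
apply/matrixP => i j; rewrite !mxE; apply/eqP; rewrite eq_complex /=.
by apply/andP; split; apply/eqP; ring.
Qed.

(** Multiplication by this matrix corrects the determinant of a unitary
    matrix. *)
Definition det_fix (z : R[i]) : M := diag_mx (\row_j if j == 0 then z else 1).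

Lemma det_det_fix z : \det (det_fix z) = z.
Proof.
rewrite det_diag big_ord_recl big1 ?mulr1; first by rewrite mxE.
by move=> j _; rewrite mxE.
Qed.

Lemma det_fixM z z' : det_fix z *m det_fix z' = det_fix (z * z').
Proof.
rewrite mulmx_diag; congr diag_mx; apply/rowP => j; rewrite !mxE.
by case: ifP => //; rewrite mulr1.
Qed.

Lemma det_fix1 : det_fix 1 = 1%:M.
Proof.
by rewrite -diag_const_mx; congr diag_mx; apply/rowP => j; rewrite !mxE if_same.
Qed.

Lemma det_fix_sub1 z : det_fix z = 1%:M + (z - 1) *: delta_mx 0 0.
Proof.
apply/matrixP => i j; rewrite !mxE; case: (eqVneq i j) => [<-|ij].
  rewrite andbb; case: (i == 0) => /=; rewrite ?mulr1n ?mulr0n; ring.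
rewrite mulr0n add0r; case: eqVneq => [i0|]; last by rewrite mulr0.
by rewrite -i0 eq_sym (negPf ij) mulr0.
Qed.

Lemma det_fix_unitary z : `|z| = 1 -> det_fix z \is unitarymx.
Proof.
move=> z1; apply/unitarymxP.
have -> : (det_fix z)^t* = det_fix z^*.
  rewrite tr_diag_mx map_diag_mx; congr diag_mx; apply/rowP => j.
  by rewrite !mxE; case: ifP => // _; rewrite rmorph1.
by rewrite det_fixM -normCK z1 expr1n det_fix1.
Qed.

Lemma det_unitary_norm (X : M) : X \is unitarymx -> `|\det X| = 1.
Proof.
move/unitarymxP => /(congr1 determinant); rewrite det_mulmx det1 det_map_mx det_tr.
by rewrite -normCK => /eqP; rewrite sqrp_eq1// => /eqP.
Qed.

Let z P := \det (cayley (skew_of P)).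

Let z_norm P : `|z P| = 1.
Proof. exact/det_unitary_norm/cayley_unitary/skew_ofP. Qed.

Let z_neq0 P : z P != 0.
Proof. by rewrite -normr_eq0 z_norm oner_neq0. Qed.

Let SU_cayley_mx P : M := cayley (skew_of P) *m det_fix (z P)^-1.

Fact SU_cayley_subproof P :
  (SU_cayley_mx P \is unitarymx) && (\det (SU_cayley_mx P) == 1).
Proof.
rewrite mul_unitarymx ?cayley_unitary ?skew_ofP//=; last first.
  by rewrite det_fix_unitary// normfV z_norm invr1.
by rewrite det_mulmx det_det_fix divff ?eqxx//; exact: z_neq0.
Qed.

Definition SU_cayley P : SU R n.+1 := SUOf (SU_cayley_subproof P).

Local Notation U := (ubound R n.+1).

Let B0 : R := n.+1%:R * n.+1%:R * 4.

Let B0_ge0 : 0 <= B0. Proof. by rewrite !mulr_ge0. Qed.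

Lemma mnorm_1skew P (b : bool) : (forall i j, 0 <= P i j <= 1) ->
  mnorm (1 + (-1) ^+ b * skew_of P) <= B0.
Proof.
move=> P01; apply: mnorm_le => i j.
have -> : (1 + (-1) ^+ b * skew_of P) i j = (1%:M : M) i j + (-1) ^+ b * skew_of P i j.
  rewrite [LHS]mxE; congr (_ + _); case: b; last by rewrite !expr0 !mul1r.
  by rewrite !expr1 !mulN1r [LHS]mxE.
rewrite (le_trans (cabsD _ _))//.
have h1 : cabs ((1%:M : M) i j) <= 1.
  by rewrite mxE; case: eqP => _; rewrite ?mulr1n ?mulr0n ?cabs1 ?cabs0.
have h2 : cabs ((-1) ^+ b * skew_of P i j) <= 3.
  have -> : cabs ((-1) ^+ b * skew_of P i j) = cabs (skew_of P i j).
    by case: b; rewrite ?expr0 ?mul1r// expr1 mulN1r cabsN.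
  rewrite mxE cabsE /=; move/andP: (P01 i j) (P01 j i) => [a1 a2] /andP[b1 b2].
  rewrite [X in _ + X]ger0_norm ?addr_ge0//.
  have : `|P i j - P j i| <= 1 by rewrite ler_norml; apply/andP; split; lra.
  lra.
lra.
Qed.

(** The quotient of the two Cayley transforms is the quotient [x] of the two
    elements of SU_n up to the determinant corrections, which change its
    [(0, 0)] entry by an unknown [a].  Since [P 0 0 = P' 0 0 = 0], the [(0, 0)]
    entry of the identity of [cayley_diff] bounds [a] by the distance of [x] to
    the identity, and the other entries then bound [P - P']. *)
Lemma SU_cayley_sep : exists2 C : R, 0 < C & forall P P',
    (forall i j, 0 <= P i j <= 1) -> (forall i j, 0 <= P' i j <= 1) ->
    P 0 0 = 0 -> P' 0 0 = 0 -> forall i j,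
  `|P i j - P' i j| <= C * dev ((SU_cayley P')^-1 * SU_cayley P)%g.
Proof.
pose N0 := mnorm (delta_mx 0 0 : M).
have N00 : 0 <= N0 by exact: mnorm_ge0.
have U0 := ltW (ubound_gt0 R n.+1).
pose C := (B0 * N0 * B0 + 1) * (B0 * (U * U) * B0).
have C0 : 0 <= C by rewrite !(addr_ge0, mulr_ge0).
exists (C + 1); first by rewrite ltr_wpDl.
move=> P P' P01 P01' P00 P00' i j.
set x := (_^-1 * _)%g; pose A := skew_of P; pose A' := skew_of P'.
have sA : A^t* = - A by exact: skew_ofP.
have sA' : A'^t* = - A' by exact: skew_ofP.
pose E' : M := det_fix (z P')^-1 *m (SU_val x - 1%:M) *m det_fix (z P).
pose a := (z P')^-1 * z P - 1.
have wE : cayley A' * (1 + (E' + a *: delta_mx 0 0)) = cayley A.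
  have -> : 1 + (E' + a *: delta_mx 0 0) = det_fix (z P')^-1 *m SU_val x *m det_fix (z P).
    rewrite /E' mulmxBr mulmx1 mulmxBl det_fixM (det_fix_sub1 (_ * z P)) -/a.
    have e (I X t : M) : I + (X - (I + t) + t) = X.
      by apply/matrixP => k m; rewrite !mxE; ring.
    exact: e.
  have assoc (a1 a2 a3 a4 : M) : a1 * (a2 *m a3 *m a4) = a1 *m a2 *m a3 *m a4.
    by rewrite -[a1 * _]/(a1 *m _) !mulmxA.
  rewrite assoc -[_ *m SU_val x]/(SU_val (SU_cayley P' * x)%g).
  by rewrite mulVKg /= -mulmxA det_fixM mulVf// det_fix1 mulmx1.
have e1 (Y : M) : 1 + Y - 1 = Y by rewrite addrC addKr.
have := cayley_diff sA sA' wE; rewrite e1.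
pose Q : M := (1 + A') * delta_mx 0 0 * (1 - A).
pose Z : M := (1 + A') * E' * (1 - A).
have -> : (1 + A') * (E' + a *: delta_mx 0 0) * (1 - A) = Z + a *: Q.
  by rewrite [X in X * _]mulrDr mulrDl -scalerAr -scalerAl.
move=> key.
have A00 : A 0 0 = 0 by rewrite mxE P00 subrr addr0.
have A00' : A' 0 0 = 0 by rewrite mxE P00' subrr addr0.
have Q00 : Q 0 0 = 1.
  rewrite /Q -[_ * _ * _]/(_ *m _ *m _) mxE (bigD1 0)//= big1; last first.
    move=> k k0; rewrite mxE big1 ?mul0r// => m _.
    by rewrite [delta_mx _ _ _ _]mxE (negPf k0) andbF mulr0.
  rewrite addr0 mxE (bigD1 0)//= big1; last first.
    by move=> k k0; rewrite [delta_mx _ _ _ _]mxE (negPf k0) mulr0.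
  rewrite addr0 [delta_mx _ _ _ _]mxE !eqxx mulr1 [(1 + A') _ _]mxE [(1 - A) _ _]mxE.
  by rewrite [(- A) _ _]mxE A00 A00' oppr0 !addr0 mxE eqxx mulr1n mulr1.
have aZ : a = - Z 0 0.
  apply/eqP; rewrite -addr_eq0 addrC.
  have /matrixP/(_ 0 0) := key; rewrite [LHS]mxE [(a *: Q) _ _]mxE Q00 mulr1 => ->.
  by rewrite mulr2n mxE [(A - A') _ _]mxE [(- A') _ _]mxE A00 A00' subrr addr0.
have b1 := mnorm_1skew false P01'; rewrite expr0 mul1r in b1.
have b2 := mnorm_1skew true P01; rewrite expr1 mulN1r in b2.
have prod3 (X Y W : M) (c : R) : mnorm X <= B0 -> mnorm Y <= c -> mnorm W <= B0 ->
    mnorm (X * Y * W) <= B0 * c * B0.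
  move=> hX hY hW; rewrite (le_trans (mnormM _ _))// ler_pM ?mnorm_ge0//.
  by rewrite (le_trans (mnormM _ _))// ler_pM ?mnorm_ge0.
have fix_le t : `|t| = 1 -> mnorm (det_fix t) <= U.
  by move=> t1; rewrite mnorm_unitary// det_fix_unitary.
have Zb : mnorm Z <= B0 * (U * U) * B0 * dev x.
  rewrite [leRHS](_ : _ = B0 * (U * dev x * U) * B0); last ring.
  apply: prod3 => //; rewrite (le_trans (mnormM _ _))//.
  rewrite ler_pM ?mnorm_ge0 ?fix_le// (le_trans (mnormM _ _))//.
  by rewrite ler_pM ?mnorm_ge0 ?fix_le// normfV z_norm invr1.
have Qb : mnorm Q <= B0 * N0 * B0 by exact: prod3.
have h : cabs (((A - A') *+ 2) i j) <= C * dev x.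
  rewrite -key mxE (le_trans (cabsD _ _))// [(a *: Q) i j]mxE.
  apply: (@le_trans _ _ (mnorm Z + mnorm Z * (B0 * N0 * B0))).
    rewrite lerD ?cabs_le_mnorm// (le_trans (cabsM _ _))// ler_pM ?cabs_ge0//.
      by rewrite aZ cabsN cabs_le_mnorm.
    exact: le_trans (cabs_le_mnorm _ _ _) Qb.
  rewrite [leLHS](_ : _ = (B0 * N0 * B0 + 1) * mnorm Z); last ring.
  rewrite /C -[leRHS]mulrA ler_wpM2l//.
  by rewrite addr_ge0// !mulr_ge0.
rewrite (le_trans _ (le_trans h _))//; last by rewrite ler_wpM2r ?dev_ge0// lerDl.
rewrite mulr2n !mxE cabsE /=; set p := P i j - P j i + _ + _; set q := _ + _ + (_ + _).
have -> : P i j - P' i j = (p + q) / 4 by rewrite /p /q; field.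
rewrite normrM [`|4^-1|]ger0_norm//.
have := ler_normD p q; have := normr_ge0 p; have := normr_ge0 q; lra.
Qed.

End cayley.

Section ball_upper_bound.
Context (R : realType) (n : nat) (mu : probability (SU R n.+1) R).
Context (mu_haar : is_Haar mu).
Local Notation G := (SU R n.+1).
Local Notation U := (ubound R n.+1).

(** The grid has [n.+1 * n] off-diagonal real parameters, each with about
    [1 / (C' * r)] values in [0, 1]. *)
Lemma bmass_le : exists2 K : R, 0 < K & exists2 r0 : R, 0 < r0 &
  forall r, 0 < r -> r <= r0 -> bmass mu r <= K * r ^+ (n.+1 * n).
Proof.
have U0 := ubound_gt0 R n.+1.
have [C C0 sep] := SU_cayley_sep R n.
(* a mesh of [C' * r] exceeds the distance that [SU_cayley_sep] allows for
   intersecting balls *)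
pose C' := C * (1 + U) + 1.
have C'0 : 0 < C' by rewrite addr_gt0// mulr_gt0// addr_gt0.
exists ((2 * C') ^+ (n.+1 * n)); first by rewrite exprn_gt0// mulr_gt0.
exists (1 / (2 * C')); first by rewrite divr_gt0// mulr_gt0.
move=> r r0; rewrite ler_pdivlMr ?mulr_gt0// => rC.
pose h := C' * r; have h0 : 0 < h by rewrite mulr_gt0.
pose k := Num.truncn (1 / h).
have hk : k%:R * h <= 1 by rewrite -ler_pdivlMr// truncn_le// divr_ge0// ltW.
have hk2 : 1 <= 2 * h * k%:R.
  have : 1 < k.+1%:R * h by rewrite -ltr_pdivrMr// truncnS_gt.
  by rewrite -natr1; move: rC; rewrite /h; lra.
pose I := ('I_n.+1 * 'I_n)%type.
pose P (f : {ffun I -> 'I_k}) : 'M[R]_n.+1 :=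
  \matrix_(i, j) if unlift i j is Some m then (f (i, m))%:R * h else 0.
have P01 f i j : 0 <= P f i j <= 1.
  rewrite mxE; case: unlift => [m|]; last by rewrite lexx ler01.
  rewrite mulr_ge0 ?(ltW h0)//= (le_trans _ hk)// ler_wpM2r ?(ltW h0)//.
  by rewrite ler_nat ltnW.
have P00 f : P f 0 0 = 0 by rewrite mxE unlift_none.
have gap f f' : f != f' -> nbd (SU_cayley (P f)) r `&` nbd (SU_cayley (P f')) r = set0.
  move=> ff'; apply: contrapT => /eqP/set0P[x [fx f'x]].
  move/eqP: ff'; apply; apply/ffunP => -[i m]; apply/val_inj => /=.
  have := sep _ _ (P01 f) (P01 f') (P00 f) (P00 f') i (lift i m).
  rewrite !mxE liftK -mulrBl normrM (gtr0_norm h0) => le1.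
  have le2 := ler_wpM2l (ltW C0) (dev_common fx f'x).
  have : `|(f (i, m))%:R - (f' (i, m))%:R| * h < 1 * h.
    rewrite (le_lt_trans le1)// (le_lt_trans le2)// mul1r /h /C'; move: r0; lra.
  rewrite ltr_pM2r// ltr_norml => /andP[l1 l2].
  have a1 : (f (i, m) < (f' (i, m)).+1)%N by rewrite -(ltr_nat R) -natr1; lra.
  have a2 : (f' (i, m) < (f (i, m)).+1)%N by rewrite -(ltr_nat R) -natr1; lra.
  by apply/eqP; rewrite eqn_leq -ltnS a1 -ltnS a2.
pose s := [seq SU_cayley (P f) | f <- enum {ffun I -> 'I_k}].
have := @mass_pack R n.+1 mu mu_haar setT s r measurableT (fun _ _ _ _ => Logic.I).
rewrite size_map -cardE card_ffun card_ord card_prod !card_ord massT => pack.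
have {}pack : (k ^ (n.+1 * n))%:R * bmass mu r <= 1.
  apply: pack; rewrite pairwise_map; apply: (sub_pairwise (r := fun f f' => f != f')).
    by move=> f f' ff'; apply/asboolP/gap.
  by rewrite -uniq_pairwise enum_uniq.
rewrite -exprMn.
have -> : 2 * C' * r = 2 * h by rewrite /h mulrA.
have b0 : 0 <= bmass mu r by exact: mass_ge0.
apply: (@le_trans _ _ ((2 * h) ^+ (n.+1 * n) * ((k ^ (n.+1 * n))%:R * bmass mu r))).
  rewrite mulrA natrX -exprMn ler_peMl// exprn_ege1//.
by rewrite ler_piMr// exprn_ge0// mulr_ge0// ltW.
Qed.

End ball_upper_bound.

(** * Convolution powers, bounded densities, balanced diagonal matrices *)

Section convolution_powers.
Context (R : realType) (n : nat) (mu : probability (SU R n) R) (l : nat).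
Local Notation U := (ubound R n).

Lemma word_measure_nbd1 r : word_measure mu l (nbd 1%g r) = mu (near_roots l r).
Proof.
rewrite /word_measure /distribution /pushforward; congr (mu _).
by apply/seteqP; split => g /=; rewrite /nbd /near_roots /= invg1 mul1g.
Qed.

Lemma convolution_power_ge t : exists2 a : R, 0 < a & forall r, 0 < r ->
  ((mass mu (near_roots l r) ^+ t)%:E <=
    convolution_power (word_measure mu l) t (nbd 1%g (a * r)))%E.
Proof.
have U0 := ubound_gt0 R n.
elim: t => [|t [a a0 IH]].
  exists 1 => // r r0; rewrite expr0 /convolution_power /= diracE.
  by rewrite mem_set//; apply: in_nbd; rewrite mul1r.
exists (1 + U * a) => [|r r0]; first by rewrite addr_gt0// mulr_gt0.
rewrite /convolution_power iterS -/(convolution_power _ t).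
set nu := convolution_power _ t in IH *.
pose A := @Defs.mul_pair R n @^-1` nbd 1%g ((1 + U * a) * r).
rewrite -[leRHS]/((word_measure mu l \x nu)%E A).
have mA : measurable A.
  rewrite -[A]setTI; apply: measurable_funP => //; exact: measurable_nbd.
apply: (@le_trans _ _ ((word_measure mu l \x nu)%E (nbd 1%g r `*` nbd 1%g (a * r)))).
  have -> : ((word_measure mu l \x nu) (nbd 1%g r `*` nbd 1%g (a * r)) =
      mu (near_roots l r) * nu (nbd 1%g (a * r)))%E.
    by rewrite -word_measure_nbd1; apply: product_measure1E; exact: measurable_nbd.
  rewrite (massE mu (measurable_near_roots _ _)).
  rewrite exprS EFinM; apply: lee_pmul; rewrite ?lee_fin ?exprn_ge0 ?mass_ge0//.
  exact: IH.
apply: le_measure; rewrite ?inE//.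
  by apply: measurableX; exact: measurable_nbd.
move=> [x y] [/=]; rewrite /A /nbd /= /Defs.mul_pair invg1 !mul1g /= => xr yr.
rewrite (le_lt_trans (devM _ _))// mulrDl mul1r ltr_leD//.
by rewrite -mulrA ler_wpM2l// ltW.
Qed.

End convolution_powers.

Lemma in_Linfty_le d (T : measurableType d) (R : realType)
    (mu : probability T R) (nu : {measure set T -> \bar R}) :
  in_Linfty mu nu -> exists2 L : R, 0 <= L &
    forall A, measurable A -> (nu A <= L%:E * mu A)%E.
Proof.
case=> f fL nuE; have /andP[mf] := fL; rewrite inE /= /finite_norm unlock.
have mu0 : (0 < mu setT)%E by rewrite probability_setT lte01.
rewrite [X in if X then _ else _]mu0 => fin.
move: mf; rewrite inE /= => mf.
set s := ess_sup _ _ in fin.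
have ae : \forall x \ae mu, (`|(f x)%:E| <= s)%E by exact: ess_sup_ge.
pose L := Num.max (fine s) 0.
have sL : (s <= L%:E)%E.
  rewrite /L; case: (s) fin => [x _||]//=; last by rewrite leNye.
  by rewrite lee_fin le_max lexx.
have L0 : 0 <= L by rewrite le_max lexx orbT.
exists L => // A mA; rewrite nuE//.
have mfA : measurable_fun A (EFin \o f).
  by apply/measurable_EFinP; exact: measurable_funS mf.
apply: (@le_trans _ _ (\int[mu]_(x in A) `|(f x)%:E|)%E).
  by apply: le_trans (lee_abs _) _; exact: le_abse_integral.
rewrite -integral_cst//; apply: ae_ge0_le_integral => //.
- exact: measurableT_comp.
- by apply: filterS ae => x /= fx _; exact: le_trans fx sL.
Qed.

Section roots_of_unity.
Context (R : realType) (l : nat) (l0 : (0 < l)%N).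

Lemma unity_roots : exists s : seq R[i],
  [/\ uniq s, size s = l & forall z, z \in s -> z ^+ l = 1].
Proof.
pose p : {poly R[i]} := 'X^l - 1; have [r Dp] := closed_field_poly_normal p.
rewrite (monicP _) ?monicXnsubC// scale1r in Dp.
exists r; split.
- by rewrite -separable_prod_XsubC -Dp separable_Xn_sub_1// pnatr_eq0 -lt0n.
- by apply/eqP; rewrite -eqSS -(size_prod_XsubC r id) -Dp size_XnsubC.
- move=> z zr; apply/eqP; rewrite -unity_rootE; move: zr.
  by rewrite -root_prod_XsubC -Dp.
Qed.

(** The quotient by [l] is injective on a residue class modulo [l]. *)
Lemma residue_count (k : nat) (i : 'I_k) :
  (#|[pred j : 'I_k | (i %% l == j %% l) && (j <= i)]| <= (i %/ l).+1)%N.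
Proof.
set A := [pred j | _].
pose f (j : 'I_k) : 'I_(i %/ l).+1 := inord (j %/ l).
rewrite -(@card_in_image _ _ f A); first by rewrite (leq_trans (max_card _))// card_ord.
move=> j j' /andP[/eqP ij ji] /andP[/eqP ij' ji'] /(congr1 val) /=.
rewrite !inordK ?ltnS ?leq_div2r// => e; apply: val_inj => /=.
by rewrite (divn_eq j l) (divn_eq j' l) e -ij -ij'.
Qed.

(** The eigenvalues run cyclically through the l-th roots of unity, except for
    the last one, which makes the determinant 1.  The exceptional row
    contributes to the linear term only. *)
Lemma balanced_diag (m : nat) : exists (d : 'rV[R[i]]_m.+1) (D : SU R m.+1),
  [/\ SU_val D = diag_mx d, (D ^+ l)%g = 1%g &
    (l * (#|block_pairs d| * 2) <= m.+1 ^ 2 + 4 * l * m.+1)%N].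
Proof.
have [s [us sl s1]] := unity_roots.
have in_s (i : nat) : s`_(i %% l) \in s by rewrite mem_nth// sl ltn_mod.
pose w := \prod_(i < m) s`_(i %% l).
pose e (i : 'I_m.+1) := if (i < m)%N then s`_(i %% l) else w^-1.
have wl : w ^+ l = 1.
  by rewrite -prodrXl big1// => i _; exact: s1.
have el i : e i ^+ l = 1.
  by rewrite /e; case: ifP => _; [exact: s1|rewrite exprVn wl invr1].
have norm1 i : `|e i| = 1.
  apply/eqP; rewrite -(@pexpr_eq1 _ _ l)// -normrX el normr1//.
pose d : 'rV[R[i]]_m.+1 := \row_i e i.
have dP : (diag_mx d \is unitarymx) && (\det (diag_mx d) == 1).
  apply/andP; split.
    apply/unitarymxP; rewrite tr_diag_mx map_diag_mx mulmx_diag -diag_const_mx.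
    congr diag_mx; apply/rowP => j.
    by rewrite !mxE -normCK norm1 expr1n.
  rewrite det_diag big_ord_recr /=.
  have -> : \prod_(i < m) d 0 (widen_ord (leqnSn m) i) = w.
    by apply: eq_bigr => i _; rewrite mxE /e /= ltn_ord.
  rewrite mxE /e /= ltnn divff//.
  by apply/eqP => w0; move/eqP: wl; rewrite w0 expr0n gtn_eqF// eq_sym oner_eq0.
exists d, (SUOf dP); split => //.
  apply: val_inj.
  have pw k : SU_val (SUOf dP ^+ k)%g = diag_mx (\row_i e i ^+ k).
    elim: k => [|k IH].
      rewrite expg0 SU_val1 -diag_const_mx; congr diag_mx; apply/rowP => j.
      by rewrite !mxE expr0.
    rewrite expgS SU_valM IH /= mulmx_diag; congr diag_mx; apply/rowP => j.
    by rewrite !mxE exprS.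
  apply: (etrans (pw l)); rewrite /= -diag_const_mx; congr diag_mx; apply/rowP => j.
  by rewrite !mxE el.
have card : #|block_pairs d| = (\sum_i #|[pred j | (i, j) \in block_pairs d]|)%N.
  rewrite -sum1_card; under [RHS]eq_bigr do rewrite -sum1_card.
  by rewrite pair_big_dep /=; apply: eq_bigl => -[].
have row_le (i : 'I_m) : (l * #|[pred j | (widen_ord (leqnSn m) i, j) \in block_pairs d]|
    <= i + l)%N.
  apply: (@leq_trans (l * (i %/ l).+1)); last first.
    by rewrite mulnS addnC leq_add2r mulnC leq_divM.
  rewrite leq_mul2l; apply/orP; right.
  apply: leq_trans (residue_count (widen_ord (leqnSn m) i)).
  apply: subset_leq_card; apply/fintype.subsetP => j; rewrite !inE /= => /andP[].
  rewrite !mxE /e /= ltn_ord => + ji; rewrite (leq_ltn_trans ji (ltn_ord i)) ji andbT.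
  by rewrite nth_uniq// sl ltn_mod.
rewrite mulnA card big_ord_recr /= mulnDr mulnDl big_distrr /=.
have h1 : (\sum_(i < m) l * #|[pred j | (widen_ord (leqnSn m) i, j) \in block_pairs d]| <=
   \sum_(i < m) (i + l))%N by apply: leq_sum => i _; exact: row_le.
have h2 : (\sum_(i < m) (i + l) * 2 <= m ^ 2 + 2 * l * m)%N.
  rewrite -big_distrl /= big_split /= sum_nat_const card_ord.
  have := bin2_sum m; rewrite big_mkord => ->.
  have : ('C(m, 2) * 2 <= m * m)%N.
    by rewrite muln2 -geq_half_double bin2 half_leq// leq_mul2l leq_pred orbT.
  by rewrite -mulnn; move: 'C(m, 2) => c; clear; lia.
have h3 : (#|[pred j | (ord_max, j) \in block_pairs d]| <= m.+1)%N.
  by rewrite (leq_trans (max_card _))// card_ord.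
have {h3} h3 := leq_mul (leqnn (l * 2)) h3.
rewrite -big_distrl /= in h2.
move: h1 h2 h3; set a := (\sum_i _)%N; set b := (\sum_i _)%N; set c := #|_|.
by move: a b c; clear; move=> a b c h1 h2 h3; rewrite -!mulnn in h2 *; lia.
Qed.

End roots_of_unity.

(** * Comparison of the exponents *)

(** With a bounded density, [r ^+ (#|block_pairs d| * 2 * t)] would be at most a
    multiple of [r ^+ (n.+1 * n)] for all small [r]. *)
Lemma not_in_Linfty (R : realType) (n l : nat) (mu : probability (SU R n.+1) R)
    (d : 'rV[R[i]]_n.+1) (D : SU R n.+1) (t : nat) : is_Haar mu ->
    SU_val D = diag_mx d -> (D ^+ l)%g = 1%g ->
    (#|block_pairs d| * 2 * t < n.+1 * n)%N ->
  ~ in_Linfty mu (convolution_power (word_measure mu l) t).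
Proof.
move=> mu_haar DE Dl dims /in_Linfty_le[L L0 nuL].
have [C [K1 [C0 K10 near_ge]]] := near_roots_mass_ge mu_haar DE Dl.
have [a a0 conv_ge] := convolution_power_ge mu l t.
have [K2 K20 [r0 r00 ball_le]] := bmass_le mu_haar.
set s := (#|block_pairs d| * 2)%N in near_ge dims; set q := (n.+1 * n)%N in ball_le dims.
pose K := K1 ^+ t * L * K2 * (a * C) ^+ q + 1.
have aC0 : 0 < a * C by rewrite mulr_gt0.
have K0 : 0 < K by rewrite ltr_wpDl// !(exprn_ge0, mulr_ge0)// ltW.
have contra r : 0 < r -> r <= 1 -> a * C * r <= r0 -> 1 <= K * r.
  move=> rp r1 rr0.
  set m := mass mu (near_roots l (C * r)).
  have m0 : 0 <= m by exact: mass_ge0.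
  have e1 : r ^+ (s * t) <= K1 ^+ t * m ^+ t.
    rewrite exprM -exprMn lerXn2r ?nnegrE ?near_ge ?exprn_ge0 ?(ltW rp)//.
    by rewrite mulr_ge0// ltW.
  have e2 : m ^+ t <= L * (K2 * (a * C * r) ^+ q).
    have mb := measurable_nbd (1%g : SU R n.+1) (a * (C * r)).
    have := le_trans (conv_ge (C * r) (mulr_gt0 C0 rp)) (nuL _ mb).
    rewrite (massE mu mb) -EFinM lee_fin => /le_trans; apply.
    by rewrite ler_wpM2l// -mulrA ball_le ?mulr_gt0// mulrA.
  have e3 : r ^+ (s * t) <= (K - 1) * r ^+ q.
    rewrite (le_trans e1)// (le_trans (ler_wpM2l _ e2)) ?exprn_ge0 ?(ltW K10)//.
    by rewrite exprMn /K addrK le_eqVlt; apply/orP; left; apply/eqP; ring.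
  have K10' : 0 <= K - 1 by rewrite /K addrK !(exprn_ge0, mulr_ge0)// ltW.
  have e4 : r ^+ q <= r ^+ (s * t) * r.
    by rewrite -exprSr; apply: ler_wiXn2l => //; exact: ltW.
  have p0 : 0 < r ^+ (s * t) by rewrite exprn_gt0.
  have : r ^+ (s * t) * 1 <= r ^+ (s * t) * (K * r).
    rewrite mulr1 (le_trans e3)// (le_trans (ler_wpM2l K10' e4))//.
    rewrite mulrCA ler_wpM2l ?(ltW p0)// ler_wpM2r ?(ltW rp)//.
    by rewrite gerBl.
  by rewrite ler_pM2l.
pose r := Num.min (Num.min 1 (r0 / (a * C))) (1 / (2 * K)).
have rp : 0 < r by rewrite !lt_min ltr01 !divr_gt0// mulr_gt0.
have : 1 <= K * r.
  apply: contra => //; first by rewrite !ge_min lexx.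
  by rewrite mulrC -ler_pdivlMr// /r !ge_min lexx orbT.
have : r <= 1 / (2 * K) by rewrite ge_min lexx orbT.
rewrite ler_pdivlMr ?mulr_gt0//; lra.
Qed.

Local Close Scope ring_scope.
Local Close Scope classical_set_scope.

Theorem proposition7p5 (R : realType) (l : nat) (hl : 2 <= l) :
  exists N : nat, forall n : nat, N <= n ->
    forall mu : probability (SU R n) R, is_Haar mu ->
      ~ in_Linfty mu (convolution_power (word_measure mu l) (l - 1)).
Proof.
exists (4 * l * l).+1 => -[//|n] hn mu mu_haar.
have [d [D [DE Dl count]]] := balanced_diag R (ltnW hl) n.
apply: (not_in_Linfty mu_haar DE Dl).
rewrite -(ltn_pmul2l (ltnW hl)) [ltnLHS]mulnA.
apply: (leq_ltn_trans (leq_mul count (leqnn _))).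
move: hl hn; case: l {d D DE Dl count mu mu_haar} => [//|k] _.
rewrite subn1 -mulnn /=; nia.
Qed.
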